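(* Let $G$ be a planar PCC graph. Then $G$ has at most $208$ vertices.
   Context: Let $G$ be a finite simple connected graph 2-cell embedded in the sphere, with vertex set $V$, edge set $E$ and face set $F$ (the outer face included). For a face $\sigma$, its size $|\sigma|$ is the length of its boundary walk. For a vertex $v$, $\deg(v)$ is its degree and $F(v)$ is the multiset of faces incident to $v$, counted with multiplicity (one entry per corner of $v$), so $\#F(v)=\deg(v)$. The combinatorial curvature of $v$ is $K(v)=1-\frac{\deg(v)}{2}+\sum_{\sigma\in F(v)}\frac{1}{|\sigma|}$. A prism of order $N$ is a planar graph with $2N$ vertices, two faces of size $N$ and $N$ faces of size $4$, every vertex incident to two $4$-faces and one $N$-face. An antiprism of order $N$ is a planar graph with $2N$ vertices, two faces of size $N$ and $2N$ triangles, every vertex incident to three triangles and one $N$-face. A (planar) PCC graph is such a $G$ with $K(v)>0$ and $\deg(v)\ge 3$ for every vertex $v$, and which is not a prism or an antiprism. *)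

(* Defs.v *)
(* Graphs 2-cell embedded in the sphere are encoded as
   combinatorial maps (rotation systems) on a finite set D of darts. *)
From HB Require Import structures.
From mathcomp Require Import all_boot all_order all_algebra all_fingroup.
Set Implicit Arguments. Unset Strict Implicit. Unset Printing Implicit Defensive.
Import Order.TTheory GRing.Theory Num.Theory.
Local Open Scope ring_scope.

Section Maps.
Variables (D : finType) (alpha sigma : {perm D}).

(* face permutation: from dart d (u->v), reverse it and rotate at v *)
Definition phi (d : D) : D := sigma (alpha d).

Definition nverts : nat := fcard sigma D.
Definition nfaces : nat := fcard phi D.
Definition nedges : nat := fcard alpha D.

Definition vdeg (d : D) : nat := fingraph.order sigma d.
Definition fsize (d : D) : nat := fingraph.order phi d.

Definition corner_sizes (d : D) : seq nat := [seq fsize e | e <- fingraph.orbit sigma d].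

Definition face_sizes : seq nat := [seq fsize x | x <- enum (froots phi)].

Definition curvature (d : D) : rat :=
  1 - (vdeg d)%:R / 2 + \sum_(e <- fingraph.orbit sigma d) ((fsize e)%:R)^-1.

Definition simple_connected_spherical_map : Prop :=
  [/\ (forall d, alpha (alpha d) = d /\ alpha d != d),
      (forall d e, connect [rel x y | (y == sigma x) || (y == alpha x)] d e),
      (* no loops *)
      (forall d, ~~ fconnect sigma d (alpha d)),
      (* no multiple edges *)
      (forall d e, fconnect sigma d e -> fconnect sigma (alpha d) (alpha e) -> d = e)
    &
      (nverts + nfaces = nedges + 2)%N].

Definition is_prism : Prop :=
  exists N : nat, [/\ (3 <= N)%N, nverts = (2 * N)%N,
    perm_eq face_sizes (nseq 2 N ++ nseq N 4%N)
  & (forall d, perm_eq (corner_sizes d) [:: 4%N; 4%N; N])].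

Definition is_antiprism : Prop :=
  exists N : nat, [/\ (3 <= N)%N, nverts = (2 * N)%N,
    perm_eq face_sizes (nseq 2 N ++ nseq (2 * N) 3%N)
  & (forall d, perm_eq (corner_sizes d) [:: 3%N; 3%N; 3%N; N])].

Definition PCC : Prop :=
  [/\ simple_connected_spherical_map,
      (forall d, 0 < curvature d),
      (forall d, (3 <= vdeg d)%N),
      ~ is_prism
    & ~ is_antiprism].

End Maps.

(* Main.v *)
(** Discharging. By Euler's formula the curvatures of all vertices sum to 2, so
    it is enough to show that their average is more than 2/209. Every vertex
    distributes at most its curvature minus 0.00957 to its corners, according
    to the sizes of the faces around it, and every edge moves some charge
    between the two faces it separates, according to the types of its two ends;
    then every face ends up with a non-negative charge. The rules were found by
    linear programming (its optimal value is 1/104, the average in the known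
    graphs with 208 vertices). They are checked by computation: the corners met
    along a face of size k form a closed walk of length k in a small weighted
    graph, and no such walk is negative.

    Faces with at least 42 sides are all treated alike, with 1/k replaced by 0.
    This loses too much only when two such faces lie on opposite sides of a
    strip of squares or of triangles. But then the strip propagates to the
    whole graph, which is a prism or an antiprism. *)

Require Import Defs.
From Stdlib Require Import ZArith Nnat.
From mathcomp Require Import all_boot all_order all_algebra all_fingroup.
From mathcomp Require Import zify ring lra ssrZ.

Set Implicit Arguments. Unset Strict Implicit. Unset Printing Implicit Defensive.
Import Order.TTheory GRing.Theory Num.Theory.
Local Open Scope nat_scope.

Delimit Scope Z_scope with coqZ.

(** * The discharging rules *)

(** The label of a corner lists the sizes of the faces around its vertex, its own
    face first, then the face across the next edge of the walk along it. Face
    sizes are truncated at 42. Each edge at the vertex also carries a mark, which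
    is stored by adding 50 to the size that precedes the edge. *)
Definition tag (s : nat) (b : bool) : nat := if b then s + 50 else s.
Definition tagged (x : nat) : bool := 50 <= x.
Definition untag (x : nat) : nat := if tagged x then x - 50 else x.
Definition sizes (U : seq nat) : seq nat := map untag U.

(** A sparse, nearly optimal solution of the linear program, in millionths. A rule for
    a corner is a correction to the default [share] below, and also applies to
    the mirror image of the corner. In a rule for an edge, the labels are those
    of its two darts, and the charge goes to the face of the first dart from
    the face of the second one; mirror images are listed. *)
Definition at_corner (U : seq nat) (z : Z) := (U, z).
Definition at_edge (U W : seq nat) (z : Z) := (U, W, z).
Definition corner_adjustments : seq (seq nat * Z) := [::
  at_corner [:: 3; 3; 3; 5; 3] 1938; at_corner [:: 3; 3; 3; 13] (-16525);
  at_corner [:: 3; 3; 3; 18] (-299); at_corner [:: 3; 3; 3; 19] (-664);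
  at_corner [:: 3; 3; 3; 20] (-993); at_corner [:: 3; 3; 3; 21] (-1291);
  at_corner [:: 3; 3; 3; 22] (-1560); at_corner [:: 3; 3; 3; 23] (-1807);
  at_corner [:: 3; 3; 3; 24] (-2034); at_corner [:: 3; 3; 3; 25] (-2243);
  at_corner [:: 3; 3; 3; 26] (-2435); at_corner [:: 3; 3; 3; 27] (-2613);
  at_corner [:: 3; 3; 3; 28] (-2778); at_corner [:: 3; 3; 3; 29] (-2932);
  at_corner [:: 3; 3; 3; 30] (-3076); at_corner [:: 3; 3; 3; 31] (-3210);
  at_corner [:: 3; 3; 3; 32] (-3336); at_corner [:: 3; 3; 3; 33] (-3455);
  at_corner [:: 3; 3; 3; 34] (-3567); at_corner [:: 3; 3; 3; 35] (-3672);
  at_corner [:: 3; 3; 3; 36] (-3770); at_corner [:: 3; 3; 3; 37] (-3865);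
  at_corner [:: 3; 3; 3; 38] (-3954); at_corner [:: 3; 3; 3; 39] (-4037);
  at_corner [:: 3; 3; 3; 40] (-4118); at_corner [:: 3; 3; 3; 41] (-4960);
  at_corner [:: 3; 3; 3; 42] (-2853); at_corner [:: 3; 3; 4; 7] 8487;
  at_corner [:: 3; 3; 4; 8] (-1049); at_corner [:: 3; 3; 4; 9] (-4519);
  at_corner [:: 3; 3; 4; 10] (-2313); at_corner [:: 3; 3; 4; 11] (-7819);
  at_corner [:: 3; 3; 5; 6] 1177; at_corner [:: 3; 3; 5; 7] (-192); at_corner [:: 3; 3; 7; 5] 190;
  at_corner [:: 3; 3; 8; 4] 1046; at_corner [:: 3; 3; 9; 4] 4519; at_corner [:: 3; 3; 10; 4] 2676;
  at_corner [:: 3; 3; 18; 3] 595; at_corner [:: 3; 3; 19; 3] 1326; at_corner [:: 3; 3; 20; 3] 1984;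
  at_corner [:: 3; 3; 21; 3] 2579; at_corner [:: 3; 3; 22; 3] 3121;
  at_corner [:: 3; 3; 23; 3] 3615; at_corner [:: 3; 3; 24; 3] 4068;
  at_corner [:: 3; 3; 25; 3] 4484; at_corner [:: 3; 3; 26; 3] 4869;
  at_corner [:: 3; 3; 27; 3] 5225; at_corner [:: 3; 3; 28; 3] 5556;
  at_corner [:: 3; 3; 29; 3] 5864; at_corner [:: 3; 3; 30; 3] 6151;
  at_corner [:: 3; 3; 31; 3] 6420; at_corner [:: 3; 3; 32; 3] 6672;
  at_corner [:: 3; 3; 33; 3] 6908; at_corner [:: 3; 3; 34; 3] 7131;
  at_corner [:: 3; 3; 35; 3] 7341; at_corner [:: 3; 3; 36; 3] 7540;
  at_corner [:: 3; 3; 37; 3] 7727; at_corner [:: 3; 3; 38; 3] 7905;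
  at_corner [:: 3; 3; 38; 53] (-1013); at_corner [:: 3; 3; 39; 3] 8074;
  at_corner [:: 3; 3; 40; 3] 8234; at_corner [:: 3; 3; 40; 53] (-8477);
  at_corner [:: 3; 3; 41; 3] 8387; at_corner [:: 3; 3; 41; 53] (-8632);
  at_corner [:: 3; 3; 42; 3] 5706; at_corner [:: 3; 53; 3; 41] (-7048);
  at_corner [:: 3; 4; 3; 11] (-2692); at_corner [:: 3; 4; 53; 11] (-2692);
  at_corner [:: 3; 4; 53; 61] (-251); at_corner [:: 3; 4; 5; 4] 446;
  at_corner [:: 3; 4; 11; 53] (-17987); at_corner [:: 3; 5; 3; 7] (-6694);
  at_corner [:: 3; 6; 40] (-11996); at_corner [:: 3; 6; 41] (-8409);
  at_corner [:: 3; 6; 42] (-3480); at_corner [:: 3; 7; 30] (-19); at_corner [:: 3; 7; 31] (-189);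
  at_corner [:: 3; 7; 32] (-714); at_corner [:: 3; 7; 33] (-867); at_corner [:: 3; 7; 34] (-1327);
  at_corner [:: 3; 7; 35] (-1467); at_corner [:: 3; 7; 36] (-1871);
  at_corner [:: 3; 7; 37] (-2037); at_corner [:: 3; 7; 38] (-2633);
  at_corner [:: 3; 7; 39] (-1074); at_corner [:: 3; 7; 40] 7781; at_corner [:: 3; 7; 41] (-2573);
  at_corner [:: 3; 8; 20] (-828); at_corner [:: 3; 8; 21] (-1941); at_corner [:: 3; 8; 22] (-3859);
  at_corner [:: 3; 8; 23] (-4791); at_corner [:: 3; 9; 16] (-1186);
  at_corner [:: 3; 9; 17] (-2868); at_corner [:: 3; 10; 10] 1709; at_corner [:: 3; 10; 11] 3969;
  at_corner [:: 3; 10; 14] (-3210); at_corner [:: 3; 11; 4; 53] (-1334);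
  at_corner [:: 3; 11; 11] 4526; at_corner [:: 3; 11; 12] (-2103);
  at_corner [:: 3; 11; 13] (-3581); at_corner [:: 3; 38; 3; 53] 1010;
  at_corner [:: 3; 38; 53; 53] 1010; at_corner [:: 3; 40; 3; 53] (-8637);
  at_corner [:: 3; 40; 53; 53] (-8637); at_corner [:: 3; 41; 53; 53] (-18066);
  at_corner [:: 53; 3; 40; 53] 160; at_corner [:: 53; 3; 41; 53] 313;
  at_corner [:: 4; 3; 3; 7] (-8489); at_corner [:: 4; 3; 3; 10] 1408;
  at_corner [:: 4; 3; 4; 5] (-5939); at_corner [:: 4; 3; 11; 3] 500;
  at_corner [:: 4; 3; 61; 3] 500; at_corner [:: 4; 53; 3; 11] 10568;
  at_corner [:: 4; 53; 61; 3] 500; at_corner [:: 4; 5; 17] 250; at_corner [:: 4; 5; 18] 1340;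
  at_corner [:: 4; 5; 19] 2314; at_corner [:: 4; 6; 11] 666; at_corner [:: 4; 7; 9] 1869;
  at_corner [:: 5; 3; 3; 3; 3] (-3877); at_corner [:: 5; 3; 3; 6] (-1178);
  at_corner [:: 5; 3; 7; 3] 887; at_corner [:: 5; 3; 40] (-4717); at_corner [:: 5; 4; 3; 4] 11433;
  at_corner [:: 5; 4; 17] (-253); at_corner [:: 5; 4; 18] (-2680); at_corner [:: 5; 4; 19] (-3625);
  at_corner [:: 5; 6; 7] (-288); at_corner [:: 6; 3; 40] (-3833); at_corner [:: 6; 3; 42] 3478;
  at_corner [:: 6; 4; 11] 666; at_corner [:: 6; 5; 7] 17; at_corner [:: 7; 3; 5; 3] 12501;
  at_corner [:: 7; 3; 37] 38; at_corner [:: 7; 3; 38] 275; at_corner [:: 7; 3; 39] 500;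
  at_corner [:: 7; 3; 40] 714; at_corner [:: 7; 3; 41] 917; at_corner [:: 7; 4; 9] (-1870);
  at_corner [:: 7; 5; 6] 269; at_corner [:: 8; 3; 20] 414; at_corner [:: 8; 3; 21] 1207;
  at_corner [:: 8; 3; 22] 1929; at_corner [:: 8; 3; 23] 2588; at_corner [:: 9; 3; 16] 308;
  at_corner [:: 9; 3; 17] 1533; at_corner [:: 10; 3; 3; 4] (-1773);
  at_corner [:: 10; 3; 10] (-856); at_corner [:: 10; 3; 11] (-3970); at_corner [:: 10; 3; 14] 1604;
  at_corner [:: 11; 3; 3; 4] 7817; at_corner [:: 11; 3; 4; 3] 4884;
  at_corner [:: 11; 3; 4; 53] 2191; at_corner [:: 11; 3; 11] (-2264);
  at_corner [:: 11; 3; 12] 1435; at_corner [:: 11; 3; 13] 5506; at_corner [:: 11; 53; 3; 4] 8752;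
  at_corner [:: 11; 4; 6] (-1334); at_corner [:: 12; 3; 11] 666; at_corner [:: 13; 3; 3; 3] 33047;
  at_corner [:: 13; 3; 11] (-1926); at_corner [:: 14; 3; 10] 1604; at_corner [:: 16; 3; 9] 877;
  at_corner [:: 17; 3; 9] 1332; at_corner [:: 18; 4; 5] 1340; at_corner [:: 19; 4; 5] 1309;
  at_corner [:: 20; 3; 8] 414; at_corner [:: 21; 3; 8] 731; at_corner [:: 22; 3; 8] 1929;
  at_corner [:: 23; 3; 8] 2203; at_corner [:: 30; 3; 7] 17; at_corner [:: 31; 3; 7] 186;
  at_corner [:: 32; 3; 7] 711; at_corner [:: 33; 3; 7] 865; at_corner [:: 34; 3; 7] 1324;
  at_corner [:: 35; 3; 7] 1464; at_corner [:: 36; 3; 7] 1869; at_corner [:: 37; 3; 7] 1998;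
  at_corner [:: 38; 3; 7] 2356; at_corner [:: 38; 53; 53; 3] (-2022); at_corner [:: 39; 3; 7] 573;
  at_corner [:: 40; 3; 53; 3] 17112; at_corner [:: 40; 3; 5] 4715; at_corner [:: 40; 3; 6] 15826;
  at_corner [:: 40; 3; 7] (-8496); at_corner [:: 40; 53; 53; 3] 17112;
  at_corner [:: 41; 3; 3; 3] 1534; at_corner [:: 41; 3; 53; 3] 15680; at_corner [:: 41; 3; 6] 8408;
  at_corner [:: 41; 3; 7] 1654; at_corner [:: 41; 53; 53; 3] 35819].
Definition edge_charges : seq (seq nat * seq nat * Z) := [::
  at_edge [:: 3; 3; 3; 3; 5] [:: 3; 3; 4; 11] (-5401);
  at_edge [:: 3; 3; 11; 4] [:: 3; 3; 5; 3; 3] (-5401);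
  at_edge [:: 3; 3; 3; 3; 5] [:: 3; 3; 11; 4] (-5401);
  at_edge [:: 3; 3; 4; 11] [:: 3; 3; 5; 3; 3] (-5401);
  at_edge [:: 3; 3; 3; 5; 3] [:: 3; 3; 3; 42] (-5401);
  at_edge [:: 3; 3; 42; 3] [:: 3; 3; 3; 5; 3] (-5401);
  at_edge [:: 3; 3; 3; 42] [:: 3; 3; 4; 11] (-4788);
  at_edge [:: 3; 3; 11; 4] [:: 3; 3; 42; 3] (-4788); at_edge [:: 3; 3; 3; 42] [:: 3; 3; 6; 5] 7196;
  at_edge [:: 3; 3; 5; 6] [:: 3; 3; 42; 3] 7196; at_edge [:: 3; 3; 3; 42] [:: 3; 3; 7; 5] (-751);
  at_edge [:: 3; 3; 5; 7] [:: 3; 3; 42; 3] (-751);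
  at_edge [:: 3; 3; 3; 42] [:: 3; 3; 11; 4] (-4788);
  at_edge [:: 3; 3; 4; 11] [:: 3; 3; 42; 3] (-4788);
  at_edge [:: 3; 3; 3; 42] [:: 3; 53; 3; 41] (-4160);
  at_edge [:: 3; 3; 41; 53] [:: 3; 3; 42; 3] (-4160);
  at_edge [:: 3; 3; 4; 11] [:: 3; 3; 11; 4] 14946; at_edge [:: 3; 4; 3; 61] [:: 4; 3; 3; 11] 4948;
  at_edge [:: 3; 4; 11; 3] [:: 4; 53; 11; 3] 4948;
  at_edge [:: 3; 4; 53; 11] [:: 4; 53; 61; 3] (-4620);
  at_edge [:: 3; 4; 53; 61] [:: 4; 3; 61; 3] (-4620);
  at_edge [:: 3; 4; 53; 61] [:: 4; 3; 3; 10] 4620; at_edge [:: 3; 4; 10; 3] [:: 4; 53; 61; 3] 4620;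
  at_edge [:: 3; 4; 53; 61] [:: 4; 3; 3; 11] 9569; at_edge [:: 3; 4; 11; 3] [:: 4; 53; 61; 3] 9569;
  at_edge [:: 3; 4; 53; 61] [:: 4; 53; 61; 3] (-9241);
  at_edge [:: 3; 4; 5; 4] [:: 4; 3; 3; 11] 4780; at_edge [:: 3; 4; 11; 3] [:: 4; 3; 4; 5] 4780;
  at_edge [:: 3; 4; 5; 4] [:: 4; 3; 4; 5] (-6385);
  at_edge [:: 3; 4; 11; 3] [:: 4; 3; 3; 11] (-11091);
  at_edge [:: 3; 4; 11; 53] [:: 4; 53; 3; 11] 20137;
  at_edge [:: 3; 5; 7; 3] [:: 5; 3; 3; 7] (-4371); at_edge [:: 3; 6; 42] [:: 6; 3; 42] (-2618);
  at_edge [:: 3; 7; 3; 5] [:: 7; 3; 3; 5] 6735; at_edge [:: 3; 7; 5; 3] [:: 7; 3; 5; 3] 6735;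
  at_edge [:: 3; 7; 7] [:: 7; 3; 41] 11048; at_edge [:: 3; 7; 41] [:: 7; 3; 7] 11048;
  at_edge [:: 3; 11; 4; 3] [:: 11; 3; 3; 4] 4547; at_edge [:: 3; 11; 4; 3] [:: 61; 3; 4; 3] 4369;
  at_edge [:: 53; 11; 3; 4] [:: 11; 3; 3; 4] 4369; at_edge [:: 3; 11; 4; 3] [:: 11; 3; 11] (-2347);
  at_edge [:: 3; 11; 11] [:: 11; 3; 3; 4] (-2347); at_edge [:: 3; 11; 4; 53] [:: 11; 3; 13] 11338;
  at_edge [:: 3; 11; 13] [:: 11; 53; 3; 4] 11338; at_edge [:: 3; 11; 11] [:: 11; 3; 13] 3192;
  at_edge [:: 3; 11; 13] [:: 11; 3; 11] 3192; at_edge [:: 3; 13; 3; 3] [:: 13; 3; 11] (-3433);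
  at_edge [:: 3; 13; 11] [:: 13; 3; 3; 3] (-3433); at_edge [:: 3; 39; 7] [:: 39; 3; 7] (-4017);
  at_edge [:: 3; 40; 3; 3] [:: 40; 3; 7] (-17112); at_edge [:: 3; 40; 7] [:: 40; 3; 3; 3] (-17112);
  at_edge [:: 3; 40; 7] [:: 40; 3; 7] (-32259); at_edge [:: 3; 41; 3; 3] [:: 41; 3; 53; 3] (-2073);
  at_edge [:: 3; 41; 53; 3] [:: 41; 3; 3; 3] (-2073);
  at_edge [:: 3; 41; 3; 3] [:: 41; 3; 7] (-14147); at_edge [:: 3; 41; 7] [:: 41; 3; 3; 3] (-14147);
  at_edge [:: 3; 41; 3; 53] [:: 41; 3; 7] 2073; at_edge [:: 3; 41; 7] [:: 41; 53; 3; 3] 2073;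
  at_edge [:: 3; 41; 53; 53] [:: 41; 3; 7] 20139; at_edge [:: 3; 41; 7] [:: 41; 53; 53; 3] 20139;
  at_edge [:: 3; 41; 7] [:: 41; 3; 7] (-47446); at_edge [:: 4; 5; 4; 3] [:: 5; 4; 19] (-3192);
  at_edge [:: 4; 5; 19] [:: 5; 4; 3; 4] (-3192); at_edge [:: 4; 11; 3; 3] [:: 11; 4; 3; 3] 10896;
  at_edge [:: 4; 11; 3; 3] [:: 11; 4; 6] (-5046); at_edge [:: 4; 11; 6] [:: 11; 4; 3; 3] (-5046);
  at_edge [:: 4; 19; 4] [:: 19; 4; 5] (-1871); at_edge [:: 4; 19; 5] [:: 19; 4; 4] (-1871);
  at_edge [:: 5; 7; 3; 3] [:: 7; 5; 3; 3] (-2598)].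

(** The corner types [a] and [b] are those of the two darts of an edge. Marks
    record a little of the second neighbourhood: rules that see only the types
    of the two ends of an edge cannot prove more than the average 1/114. *)
Definition marking (a : seq nat) : bool :=
  if a is [:: x; y; z; t] then
    if x == 3 then
      if y == 3 then
        [|| (z == 4) && (t == 11), (z == 11) && (t == 4), (z == 3) && (30 <= t < 42)
          | (t == 3) && (30 <= z < 42)]
      else [&& y == 11, z == 3 & t == 4]
    else [&& x == 11, y == 3, z == 4 & t == 3]
  else false.

(** [marking] depends on the near end alone, so that tags can be enumerated without knowing the far
    end. Marked edges lead from 3.3.4.11 to 3.3.3.13, from 3.4.3.11 to 3.3.4.11, and from 3.3.3.t
    with 30 <= t < 42 to 3.3.5.7. *)
Definition mark (a b : seq nat) : bool :=
  marking a &&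
  (b \in (if 4 \in a then
            if nth 0 a 1 == nth 0 a 0 then [:: [:: 3; 3; 3; 13]; [:: 3; 3; 13; 3]]
            else [:: [:: 11; 3; 3; 4]; [:: 3; 11; 4; 3]]
          else [:: [:: 3; 3; 5; 7]; [:: 3; 3; 7; 5]])).

(** [part x] is [1/x] in units of [1/lcm42]. A size 42 stands for all larger
    sizes, so that [part] gives an upper bound of the curvature; [recip] and [curv]
    below give a lower bound, in millionths, by rounding down and counting
    nothing for large faces. *)
Definition lcm42 : Z := 219060189739591200.

Definition parts : seq Z := [seq (lcm42 / Z.of_nat x)%coqZ | x <- iota 0 43].
Definition part (x : nat) : Z := nth 0%coqZ parts x.

(** Pruned search: an entry is kept only if triangles in all remaining places would still exceed
    [need]. *)
Fixpoint tuples (d : nat) (need : Z) : seq (seq nat) :=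
  if d is d'.+1 then
    flatten [seq [seq x :: s | s <- tuples d' (need - part x)%coqZ]
            | x <- iota 3 40 & Z.ltb need (part x + Z.of_nat d' * part 3)]
  else if Z.ltb need 0 then [:: [::]] else [::].

(** Positive curvature at degree [d + 1] means that the reciprocals sum to more than (d - 1)/2, and
    [part 2] stands for 1/2. Degrees above five are impossible when all faces have at least three
    sides. *)
Definition corner_tuples (k : nat) : seq (seq nat) :=
  flatten [seq map (cons k) (tuples d ((Z.of_nat d - 1) * part 2 - part k)%coqZ)
          | d <- [:: 2; 3; 4]].

Fixpoint taggings (bs : seq bool) : seq (seq bool) :=
  if bs is b :: bs' then
    flatten [seq [seq c :: l | l <- taggings bs'] | c <- if b then [:: false; true] else [:: false]]
  else [:: [::]].

Definition labels_of (t : seq nat) : seq (seq nat) :=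
  [seq [seq tag p.1 p.2 | p <- zip t bs]
  | bs <- taggings [seq marking (rot i t) | i <- iota 0 (size t)]].

Definition labels (k : nat) : seq (seq nat) := flatten (map labels_of (corner_tuples k)).

(** The own face stays first while the other faces are reversed. The tags belong to the edges
    between consecutive faces, so their list is reversed as a whole. *)
Definition mirror (U : seq nat) : seq nat :=
  let s := sizes U in
  [seq tag p.1 p.2 | p <- zip (head 0 s :: rev (behead s)) (rev (map tagged U))].

Definition lookup (T : eqType) (x : T) (tab : seq (T * Z)) : Z :=
  foldr (fun p r => if p.1 == x then p.2 else r) 0%coqZ tab.

Definition micro : Z := 1000000.
Definition target : Z := 9570.

Definition recip (s : nat) : Z := if s < 42 then (micro / Z.of_nat s)%coqZ else 0%coqZ.
Definition curv (t : seq nat) : Z :=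
  (micro - (micro / 2) * Z.of_nat (size t) + foldr (fun s r => recip s + r) 0 t)%coqZ.

(** By default a vertex shares its charge equally between its corners, except
    that large faces get nothing. *)
Definition share (t : seq nat) : Z :=
  if head 0 t == 42 then 0%coqZ
  else ((curv t - target) / (Z.of_nat (size t) - Z.b2z (42 \in t)%N))%coqZ.

Definition corner_charge_in (tab : seq (seq nat * Z)) (U : seq nat) : Z :=
  (share (sizes U) + lookup U tab)%coqZ.

Definition adjustments (k : nat) :=
  let tab := [seq p <- corner_adjustments | untag (head 0 p.1) == k] in
  tab ++ [seq (mirror p.1, p.2) | p <- tab].

Definition adjustment_tables := map adjustments (iota 0 43).

Definition corner_charge (U : seq nat) : Z :=
  corner_charge_in (nth [::] adjustment_tables (untag (head 0 U))) U.

Definition charges_from (U : seq nat) :=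
  [seq (p.1.2, p.2) | p <- edge_charges & p.1.1 == U].
Definition charges_to (U : seq nat) :=
  [seq (p.1.1, p.2) | p <- edge_charges & p.1.2 == U].
Definition edge_charge (U W : seq nat) : Z :=
  (lookup W (charges_from U) - lookup W (charges_to U))%coqZ.

Definition vertex_ok (U : seq nat) : bool :=
  (foldr (fun i r => corner_charge (rot i U) + r) 0 (iota 0 (size U))
     <=? curv (sizes U) - target)%coqZ.

(** [u] and [w] are the corner types of the two darts of an edge. The first
    excluded pattern is a square between two large faces, the second one an edge
    inside a strip of triangles between two large faces. *)
Definition joined_sizes (u w : seq nat) : bool :=
  ~~ [&& head 0 u == 4, last 0 u == 42 & nth 0 w 2 == 42] &&
  ~~ ((u == w) && (u \in [:: [:: 3; 3; 42; 3]; [:: 3; 3; 3; 42]])).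

Definition notable_types : seq (seq nat) :=
  undup ([:: [:: 4; 4; 42]; [:: 3; 4; 42]; [:: 3; 3; 3; 42]; [:: 3; 3; 4; 11]; [:: 3; 3; 3; 13]; [:: 3; 3; 5; 7]]
   ++ [seq [:: 3; 3; 3; k] | k <- iota 30 12]
   ++ flatten [seq [:: sort leq (sizes p.1.1); sort leq (sizes p.1.2)] | p <- edge_charges]).

(** Caches what the arcs need. [olab] and [oszs], turned back by one place, describe the reversed
    dart of the edge by which a walk enters the corner. *)
Record corner := Corner {
  lab : seq nat; olab : seq nat; szs : seq nat; oszs : seq nat; charge : Z;
  notable : bool; tag_out : bool; tag_in : bool; into : nat; outof : nat }.

Definition corner_of tab (U : seq nat) : corner :=
  let s := sizes U in
  Corner U (rotr 1 U) s (rotr 1 s) (corner_charge_in tab U) (sort leq s \in notable_types)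
    (tagged (head 0 U)) (tagged (last 0 U)) (last 0 s) (nth 0 s 1).

(** Outside of the notable types the edge charges vanish and, there being no mark to
    compare, the test of compatibility may be skipped. *)
Definition step_cost (c : corner) : corner -> option Z :=
  let from := charges_from (lab c) in
  let to := charges_to (lab c) in
  fun d =>
  if notable c && notable d || (tag_out c || tag_in d) then
    if [&& tag_out c == mark (szs c) (oszs d), tag_in d == mark (oszs d) (szs c)
         & joined_sizes (szs c) (oszs d)]
    then Some (charge d + (lookup (olab d) from - lookup (olab d) to))%coqZ else None
  else Some (charge d).

Definition corners (k : nat) : seq corner := map (corner_of (adjustments k)) (labels k).

Definition corners_into (k : nat) : seq (seq (N * corner)) :=
  let cs := corners k in
  let ics := zip (map N.of_nat (iota 0 (size cs))) cs in
  [seq [seq p <- ics | into p.2 == g] | g <- iota 0 43].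

Definition arcs_from (buckets : seq (seq (N * corner))) (c : corner) : seq (N * Z) :=
  let cost := step_cost c in
  pmap (fun p => omap (pair p.1) (cost p.2)) (nth [::] buckets (outof c)).

Definition walk_graph (k : nat) : seq (seq (N * Z)) :=
  map (arcs_from (corners_into k)) (corners k).

(** * Negative closed walks *)

Section ClosedWalks.
Variable graph : seq (seq (N * Z)).

Definition arcs (i : N) : seq (N * Z) := nth [::] graph (N.to_nat i).

(** A negative closed walk has a starting point from which all its partial sums are
    negative, so the search drops every walk whose sum is non-negative. *)
Definition extend (p : N * Z) : seq (N * Z) :=
  pmap (fun q => let z := (p.2 + q.2)%coqZ in if (z <? 0)%coqZ then Some (q.1, z) else None)
       (arcs p.1).

Fixpoint insert (p : N * Z) (D : seq (N * Z)) : seq (N * Z) :=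
  if D is q :: D' then
    if N.eqb q.1 p.1 then (q.1, Z.min q.2 p.2) :: D' else q :: insert p D'
  else [:: p].

(** Merging the walks with a common end pays only if the walks are long. *)
Definition walk_step (small : bool) (D : seq (N * Z)) : seq (N * Z) :=
  let E := flatten (map extend D) in if small then E else foldr insert [::] E.

Definition closes (c : N) (p : N * Z) : bool :=
  has (fun q => N.eqb q.1 c && (p.2 + q.2 <? 0)%coqZ) (arcs p.1).

Definition no_negative_cycle (k : nat) : bool :=
  all (fun i => let c := N.of_nat i in
                ~~ has (closes c) (iter k.-1 (walk_step (k <= 4)) [:: (c, 0%coqZ)]))
      (iota 0 (size graph)).

End ClosedWalks.

Definition face_ok (k : nat) : bool := no_negative_cycle (walk_graph k) k.

(** * Soundness of the search for negative closed walks *)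

Section Soundness.
Variable graph : seq (seq (N * Z)).

(** Merging keeps the cheaper of two walks with the same end, so an entry is only ever replaced by a
    smaller one. *)
Lemma insert_le (p q : N * Z) (D : seq (N * Z)) :
  q \in p :: D -> exists2 z : Z, (q.1, z) \in insert p D & (z <= q.2)%coqZ.
Proof.
elim: D => [|r D IH] /=.
  by rewrite inE => /eqP ->; exists p.2; rewrite ?inE -?surjective_pairing //; lia.
rewrite !inE; case: N.eqb_spec => [e|ne].
  case/or3P => [/eqP ->|/eqP ->|qD].
  - by exists (Z.min r.2 p.2); rewrite ?inE ?e ?eqxx //; lia.
  - by exists (Z.min r.2 p.2); rewrite ?inE ?eqxx //; lia.
  - by exists q.2; rewrite -?surjective_pairing ?inE ?qD ?orbT //; lia.
case/or3P => [qp|/eqP ->|qD].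
- by have [|z zD lez] := IH; [rewrite inE qp | exists z; rewrite // inE zD orbT].
- by exists r.2; rewrite -?surjective_pairing ?inE ?eqxx //; lia.
- by have [|z zD lez] := IH; [rewrite inE qD orbT | exists z; rewrite // inE zD orbT].
Qed.

Lemma walk_step_le small (D : seq (N * Z)) i z j x :
    (i, z) \in D -> (j, x) \in arcs graph i -> (z + x < 0)%coqZ ->
  exists2 z' : Z, (j, z') \in walk_step graph small D & (z' <= z + x)%coqZ.
Proof.
move=> iD jx neg.
have jE : (j, (z + x)%coqZ) \in flatten (map (extend graph) D).
  apply/flattenP; exists (extend graph (i, z)); first exact: map_f.
  rewrite mem_pmap; apply/mapP; exists (j, x) => //=.
  by case: Z.ltb_spec => //; lia.
rewrite /walk_step; case: small; first by exists (z + x)%coqZ => //; lia.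
move: jE; elim: (flatten _) => //= q E IH.
rewrite inE => /orP[/eqP <-|/IH [z' z'E le]].
  by have [|z' ? ?] := @insert_le (j, (z + x)%coqZ) (j, (z + x)%coqZ) (foldr insert [::] E);
    [rewrite inE eqxx | exists z'].
have [|z2 ? le2] := @insert_le q (j, z') (foldr insert [::] E).
  by rewrite inE z'E orbT.
by exists z2 => //; move: le2 => /=; lia.
Qed.

(** A form of the cycle lemma: start the walk at the last maximum of the prefix sums [S]. *)
Lemma prefix_max (x : nat -> Z) k : 0 < k -> (forall i, x (i + k) = x i) ->
    (\sum_(i < k) x i < 0)%R ->
  exists2 j, j < k & forall r, 0 < r <= k -> (\sum_(j <= i < j + r) x i < 0)%R.
Proof.
move=> k0 per neg.
pose S i : Z := (\sum_(0 <= t < i) x t)%R.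
have SD i r : (\sum_(i <= t < i + r) x t = S (i + r) - S i)%R.
  have -> : S (i + r) = (S i + \sum_(i <= t < i + r) x t)%R by rewrite -big_cat_nat ?leq_addr.
  by ring.
have Sk i : S (i + k) = (S i + S k)%R.
  rewrite /S addnC (big_cat_nat (n := k)) ?leq_addr //= addrC; congr (_ + _)%R.
  rewrite -{1}[k]add0n big_addn addKn.
  by apply: eq_bigr => t _; rewrite per.
have {}neg : (S k < 0)%R by rewrite /S big_mkord.
(* The weight [k] lets [S] decide first; the added index breaks ties in favour of the last maximum,
   so that later prefix sums are strictly smaller. Those that wrap around drop by the negative total
   [S k]. *)
have [j _ jmax] : exists2 j : 'I_k, true &
    forall i : 'I_k, (S i * Z.of_nat k + Z.of_nat i <= S j * Z.of_nat k + Z.of_nat j)%coqZ.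
  case: k k0 {per} @S SD Sk neg => // k _ S SD Sk neg.
  pose f (i : 'I_k.+1) := (S i * Z.of_nat k.+1 + Z.of_nat i)%coqZ.
  have [j _ jm] := @Order.TotalTheory.arg_maxP _ _ _ (@ord0 k) xpredT f isT.
  by exists j => // i; have := jm i isT; rewrite /f; lia.
exists j => // r /andP[r0 rk]; rewrite SD.
have jk := ltn_ord j.
case: (ltnP (j + r) k) => [lt|ge].
  have /= := jmax (Ordinal lt); move: (S _) (S j) => a b; nia.
have lt : j + r - k < k by lia.
have /= := jmax (Ordinal lt).
have -> : S (j + r) = (S (j + r - k)%N + S k)%R by rewrite -Sk subnK.
move: (S _) (S j) (S k) neg => a b c; nia.
Qed.

(** Started at the index given by [prefix_max], a negative closed walk is never dropped: after [n]
    steps the search holds, at the same end, a value at most its partial sum [P n], and the last arc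
    then closes it. *)
Lemma no_negative_cycleP k (w : nat -> N) (x : nat -> Z) :
    0 < k -> no_negative_cycle graph k ->
    (forall i, w (i + k) = w i) -> (forall i, x (i + k) = x i) ->
    (forall i, (w i.+1, x i) \in arcs graph (w i)) ->
  (0 <= \sum_(i < k) x i)%R.
Proof.
move=> k0 ok wper xper arc; rewrite leNgt; apply/negP => neg.
have [j _ jneg] := prefix_max k0 xper neg.
pose P r : Z := (\sum_(j <= i < j + r) x i)%R.
have P0 : P 0 = 0%coqZ by rewrite /P addn0 big_geq.
have PS r : P r.+1 = (P r + x (j + r)%N)%coqZ by rewrite /P addnS big_nat_recr ?leq_addr.
have {}jneg r : 0 < r <= k -> (P r < 0)%coqZ by move=> /jneg; rewrite -/(P r); lia.
pose D n := iter n (walk_step graph (k <= 4)) [:: (w j, 0%coqZ)].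
have reach n : n < k -> exists2 z : Z, (w (j + n), z) \in D n & (z <= P n)%coqZ.
  elim: n => [|n IH] ltn.
    by exists 0%coqZ; rewrite ?P0 ?addn0 ?inE //; lia.
  have [z zD le] := IH (ltnW ltn).
  have := jneg n.+1 (ltnW ltn); rewrite PS => neg'.
  have [|z' z'D le'] := @walk_step_le (k <= 4) (D n) _ z _ _ zD (arc (j + n)); first by lia.
  by exists z'; rewrite ?PS ?addnS //; lia.
have [|z zD le] := reach k.-1; first by lia.
have /allP/(_ (N.to_nat (w j))) := ok.
rewrite mem_iota /= add0n.
(* An index with an outgoing arc is in range, since [arcs] is empty by default elsewhere. *)
have -> : N.to_nat (w j) < size graph.
  rewrite ltnNge; apply/negP => big.
  by have := arc j; rewrite /arcs nth_default.
rewrite N2Nat.id => /(_ isT) /hasPn/(_ _ zD) /negP; apply.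
apply/hasP; exists (w j, x (j + k.-1)).
  by have := arc (j + k.-1); rewrite -addnS prednK // wper.
rewrite /= N.eqb_refl /=.
have := jneg k; rewrite leqnn k0 -{1}(prednK k0) PS => /(_ isT).
by case: Z.ltb_spec => //; lia.
Qed.

End Soundness.

(** * Completeness of the enumeration of corners *)

Definition parts_sum (t : seq nat) : Z := foldr (fun x r => part x + r)%coqZ 0%coqZ t.
Definition in_range (x : nat) : bool := 3 <= x <= 42.

Lemma in_range_iota x : in_range x = (x \in iota 3 40).
Proof. by rewrite mem_iota. Qed.

Lemma part_le3 x : in_range x -> (part x <= part 3)%coqZ.
Proof.
rewrite in_range_iota => xr; apply/Z.leb_le; move: x xr; apply/allP.
by vm_compute.
Qed.

#[local] Arguments part : simpl never.
#[local] Arguments Z.of_nat : simpl never.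
#[local] Arguments Z.mul : simpl never.

Lemma parts_sum_le t : all in_range t -> (parts_sum t <= Z.of_nat (size t) * part 3)%coqZ.
Proof.
elim: t => [|x t IH] //= /andP[/part_le3 le3 /IH]; rewrite -/(parts_sum t) Nat2Z.inj_succ.
by move: (part x) (part 3) (parts_sum t) le3 => a b c; lia.
Qed.

Lemma tuplesS d need : tuples d.+1 need =
  flatten [seq [seq x :: s | s <- tuples d (need - part x)%coqZ]
          | x <- iota 3 40 & Z.ltb need (part x + Z.of_nat d * part 3)].
Proof. by []. Qed.

Lemma mem_tuples t need : all in_range t -> (need < parts_sum t)%coqZ ->
  t \in tuples (size t) need.
Proof.
elim: t need => [|x t IH] need.
  by move=> _; rewrite /parts_sum /= => lt; case: Z.ltb_spec => //; lia.
rewrite [all _ _]/= [parts_sum _]/= -/(parts_sum t) => /andP[xr tr] lt.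
rewrite [size _]/= tuplesS; apply/flattenP.
exists [seq x :: s | s <- tuples (size t) (need - part x)%coqZ]; last first.
  by apply: map_f; apply: IH => //; lia.
apply: (map_f (fun x => [seq x :: s | s <- tuples (size t) (need - part x)%coqZ])).
rewrite mem_filter -in_range_iota xr andbT.
by have := parts_sum_le tr; case: Z.ltb_spec => //; lia.
Qed.

Lemma mem_corner_tuples t : all in_range t -> 3 <= size t <= 5 ->
    ((Z.of_nat (size t) - 2) * part 2 < parts_sum t)%coqZ ->
  t \in corner_tuples (head 0 t).
Proof.
case: t => [|k t]; first by [].
rewrite [all _ _]/= [size _]/= [head _ _]/= [parts_sum _]/= -/(parts_sum t).
move=> /andP[_ tr] sz lt; apply/flattenP.
exists (map (cons k) (tuples (size t) ((Z.of_nat (size t) - 1) * part 2 - part k)%coqZ)).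
  apply: (map_f (fun d => map (cons k) (tuples d ((Z.of_nat d - 1) * part 2 - part k)%coqZ))).
  by rewrite !inE; lia.
by apply: map_f; apply: mem_tuples => //; lia.
Qed.

Lemma mem_taggings cs bs : size cs = size bs ->
  (forall i, nth false cs i -> nth false bs i) -> cs \in taggings bs.
Proof.
elim: bs cs => [|b bs IH] [|c cs] //= [sz] imp; apply/flattenP.
exists [seq c :: l | l <- taggings bs].
  apply: (map_f (fun c => [seq c :: l | l <- taggings bs])).
  by have := imp 0; case: b {imp} => /=; case: c => // /(_ isT).
by apply: map_f; apply: IH => // i; apply: (imp i.+1).
Qed.

Lemma mem_labels (t : seq nat) (cs : seq bool) :
    t \in corner_tuples (head 0 t) -> size cs = size t ->
    (forall i, i < size t -> nth false cs i -> marking (rot i t)) ->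
  [seq tag p.1 p.2 | p <- zip t cs] \in labels (head 0 t).
Proof.
move=> tk sz imp; apply/flattenP; exists (labels_of t); first exact: map_f.
apply: (map_f (fun bs => [seq tag p.1 p.2 | p <- zip t bs])).
apply: mem_taggings => [|i ci]; first by rewrite size_map size_iota.
have it : i < size t by rewrite -sz ltnNge; apply/negP => ge; rewrite nth_default in ci.
by rewrite (nth_map 0) ?size_iota // nth_iota // add0n; apply: imp.
Qed.

Lemma untag_tag s b : s <= 42 -> untag (tag s b) = s.
Proof. by rewrite /untag /tagged /tag; case: b => le; case: leqP; lia. Qed.

Lemma tagged_tag s b : s <= 42 -> tagged (tag s b) = b.
Proof. by rewrite /tagged /tag; case: b => le; apply/idP/idP; lia. Qed.

(** * Edge charges and the arcs of the walk graph *)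

Lemma lookup_notin (T : eqType) (x : T) tab : x \notin map fst tab -> lookup x tab = 0%coqZ.
Proof.
elim: tab => //= p tab IH; rewrite inE negb_or eq_sym => /andP[/negPf -> ?].
exact: IH.
Qed.

Lemma lookup_from U W : lookup W (charges_from U) = lookup (U, W) edge_charges.
Proof.
rewrite /charges_from; elim: edge_charges => //= -[[u w] z] tab IH /=.
by rewrite xpair_eqE; case: eqP => //= _; rewrite IH.
Qed.

Lemma lookup_to U W : lookup W (charges_to U) = lookup (W, U) edge_charges.
Proof.
rewrite /charges_to; elim: edge_charges => //= -[[u w] z] tab IH /=.
by rewrite xpair_eqE andbC; case: eqP => //= _; rewrite IH.
Qed.

Lemma edge_chargeC U W : edge_charge W U = (- edge_charge U W)%coqZ.
Proof. rewrite /edge_charge !lookup_from !lookup_to.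
by move: (lookup _ _) (lookup _ _) => a b; lia. Qed.

Lemma edge_charge_eq0 U W : (U, W) \notin map fst edge_charges ->
  (W, U) \notin map fst edge_charges -> edge_charge U W = 0%coqZ.
Proof. by move=> ? ?; rewrite /edge_charge lookup_from lookup_to !lookup_notin. Qed.

Definition notable_label (U : seq nat) := sort leq (sizes U) \in notable_types.

Lemma edge_charge_notable U W : ~~ (notable_label U && notable_label W) ->
  edge_charge U W = 0%coqZ.
Proof.
have chk : all (fun p => notable_label p.1 && notable_label p.2) (map fst edge_charges).
  by vm_compute.
move=> /negP not; apply: edge_charge_eq0; apply/negP => /(allP chk) nn; apply: not.
  exact: nn.
by rewrite andbC; exact: nn.
Qed.

(** No edge rule involves a large face. As its corners get nothing either, such a face ends with
    charge zero, and no walk has to be examined for it. *)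
Lemma edge_charge_large U W : untag (head 0 U) = 42 -> edge_charge U W = 0%coqZ.
Proof.
have chk : all (fun p => (untag (head 0 p.1) != 42) && (untag (head 0 p.2) != 42))
               (map fst edge_charges).
  by vm_compute.
move=> h; apply: edge_charge_eq0; apply/negP => /(allP chk) /andP[]; rewrite [_.1]/= [_.2]/= h.
  by rewrite eqxx.
by rewrite eqxx.
Qed.

Lemma head_sizes U : U != [::] -> head 0 (sizes U) = untag (head 0 U).
Proof. by case: U. Qed.

Lemma corner_charge_large U : U != [::] -> untag (head 0 U) = 42 -> corner_charge U = 0%coqZ.
Proof.
move=> U0 h; rewrite /corner_charge h.
have -> : nth [::] adjustment_tables 42 = [::] by vm_compute.
by rewrite /corner_charge_in /share head_sizes // h.
Qed.

Lemma adjustmentsE k : k <= 42 -> nth [::] adjustment_tables k = adjustments k.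
Proof.
move=> le; have lt : k < size (iota 0 43) by rewrite size_iota; exact: le.
rewrite /adjustment_tables (nth_map 0 [::] adjustments lt) nth_iota ?add0n; last exact: le.
exact: erefl.
Qed.

Lemma sizes_rotr U : sizes (rotr 1 U) = rotr 1 (sizes U).
Proof. by rewrite /sizes map_rotr. Qed.

Lemma mem_pmap_filter_nth (T : Type) (R : eqType) (f : T -> option R) (P : pred T) x0 s i u :
  i < size s -> P (nth x0 s i) -> f (nth x0 s i) = Some u -> u \in pmap f (filter P s).
Proof.
elim: s i => //= x s IH [_ /= -> /= ->|i lt Pi fi]; first by rewrite /= inE eqxx.
by case: ifP => _ /=; rewrite ?mem_oapp; move: (IH i lt Pi fi); case: (f x) => //= y;
  rewrite inE => ->; rewrite orbT.
Qed.

Definition label_index k U : N := N.of_nat (index U (labels k)).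

(** Compatibility of consecutive corners of a face walk: both ends must agree on the face across
    their common edge and on its two marks. [rotr 1] passes from the corner [V] to the reversed dart
    of that edge. *)
Definition joined (U V : seq nat) : bool :=
  let u := sizes U in let w := rotr 1 (sizes V) in
  [&& nth 0 u 1 == last 0 (sizes V), tagged (head 0 U) == mark u w,
      tagged (last 0 V) == mark w u & joined_sizes u w].

(* Otherwise simplification unfolds the tables. *)
#[local] Opaque edge_charges corner_adjustments notable_types.

Lemma step_cost_of tab U V : joined U V ->
  step_cost (corner_of tab U) (corner_of tab V) =
    Some (corner_charge_in tab V + edge_charge U (rotr 1 V))%coqZ.
Proof.
move=> /and4P[_ tU tV jn]; rewrite /step_cost /= tU tV jn /=.
(* If the test is skipped, one of the corners is not notable and the omitted edge charge is zero. *)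
case: ifP => // /norP[not _]; rewrite edge_charge_notable ?Z.add_0_r //.
apply: contra not; rewrite /notable_label sizes_rotr.
have srt := perm_sortP leq_total leq_trans anti_leq.
have -> : sort leq (rotr 1 (sizes V)) = sort leq (sizes V) by apply/srt; rewrite perm_rotr.
exact.
Qed.

Lemma walk_graph_arc k U V : k <= 42 -> U \in labels k -> V \in labels k ->
    untag (head 0 V) = k -> nth 0 (sizes U) 1 < 43 -> joined U V ->
  (label_index k V, (corner_charge V + edge_charge U (rotr 1 V))%coqZ)
    \in arcs (walk_graph k) (label_index k U).
Proof.
move=> k42 Uk Vk hV out jUV; have /and4P[/eqP io _ _ _] := jUV.
rewrite /arcs /label_index Nat2N.id.
have iU : index U (labels k) < size (labels k) by rewrite index_mem.
have iV : index V (labels k) < size (labels k) by rewrite index_mem.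
have szc : size (corners k) = size (labels k) by rewrite size_map.
pose c0 := corner_of [::] [::].
have cE W : W \in labels k -> nth c0 (corners k) (index W (labels k)) = corner_of (adjustments k) W.
  by move=> Wk; rewrite (nth_map [::]) ?index_mem // nth_index.
rewrite (nth_map c0) ?szc // cE //; set c := corner_of _ U; set d := corner_of (adjustments k) V.
have o43 : outof c < size (iota 0 43) by rewrite size_iota; exact: out.
rewrite /arcs_from /corners_into (nth_map 0 [::] _ o43) nth_iota ?size_iota; last exact: out.
set ics := zip _ _.
have nE : nth (N0, c0) ics (index V (labels k)) = (label_index k V, d).
  have lt : index V (labels k) < size (iota 0 (size (labels k))).
    by rewrite size_iota; exact: iV.
  rewrite nth_zip ?size_map ?size_iota ?szc; last exact: erefl.
  rewrite cE; last exact: Vk.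
  rewrite (nth_map 0 N0 N.of_nat lt) nth_iota; last exact: iV.
  rewrite add0n; exact: erefl.
apply: (@mem_pmap_filter_nth _ _ _ _ (N0, c0) _ (index V (labels k))).
- rewrite size_zip !size_map size_iota minnn; exact: iV.
- by rewrite nE add0n; apply/eqP; exact: esym io.
rewrite nE [_.1]/= [_.2]/= step_cost_of; last exact: jUV.
by rewrite /corner_charge hV adjustmentsE.
Qed.

(** The main computation. Size 42 is left out: it stands for all larger sizes too, so no single walk
    length belongs to it. *)
Lemma faces_ok k : 3 <= k <= 41 -> no_negative_cycle (walk_graph k) k.
Proof.
have chk : all face_ok (iota 3 39) by vm_compute.
move=> le; have : face_ok k by apply: (allP chk); rewrite mem_iota.
by rewrite /face_ok.
Qed.

Lemma vertices_ok k U : in_range k -> U \in labels k -> vertex_ok U.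
Proof.
have chk : all (fun k => all vertex_ok (labels k)) (iota 3 40) by vm_compute.
by rewrite in_range_iota => /(allP chk) /allP; apply.
Qed.

(** * Sums over orbits *)

Section Orbits.
Variables (T : finType) (f : T -> T).
Hypothesis f_inj : injective f.
Notation order := (fingraph.order f).
Notation orbit := (fingraph.orbit f).

Lemma order_step x : order (f x) = order x.
Proof. by apply/eq_card => y; rewrite !inE -same_fconnect1. Qed.

Lemma orbit_step x : orbit (f x) = rot 1 (orbit x).
Proof.
rewrite /fingraph.orbit order_step -orderSpred trajectSr /= rot1_cons.
by rewrite -iterSr orderSpred iter_order.
Qed.

Lemma orbit_iter i x : i <= order x -> orbit (iter i f x) = rot i (orbit x).
Proof.
elim: i => [|i IH] lt; first by rewrite rot0.
rewrite iterS orbit_step IH; last exact: ltnW.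
by rewrite -rotS ?size_orbit.
Qed.

Lemma nth_orbit x0 x i : i < order x -> nth x0 (orbit x) i = iter i f x.
Proof. by move=> lt; rewrite (set_nth_default x) ?size_orbit // nth_traject. Qed.

Lemma orbit_rec x : orbit x = x :: behead (orbit x).
Proof. by rewrite /fingraph.orbit -orderSpred. Qed.

Lemma iter_periodic i x : iter (i + order x) f x = iter i f x.
Proof. by rewrite iterD iter_order. Qed.

Lemma sum_orbit (R : nmodType) (F : T -> R) x :
  (\sum_(e <- orbit x) F e = \sum_(i < order x) F (iter i f x))%R.
Proof.
rewrite (big_nth x) size_orbit big_mkord.
by apply: eq_bigr => i _; rewrite nth_traject.
Qed.

(** The basis of all double counting below: sums over darts are grouped by vertices when [f] is
    [sigma] and by faces when it is [phi]. *)
Lemma sum_froots (R : nmodType) (F : T -> R) :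
  (\sum_d F d = \sum_(r | froots f r) \sum_(e <- orbit r) F e)%R.
Proof.
rewrite (partition_big (froot f) (froots f)) /=; last first.
  by move=> d _; apply: roots_root; apply: fconnect_sym.
apply: eq_bigr => r /eqP rr; rewrite big_uniq ?orbit_uniq //=.
apply: eq_bigl => d; rewrite -fconnect_orbit -(root_connect (fconnect_sym f_inj)) rr.
by rewrite eq_sym.
Qed.

Lemma sum_froots_le (F G : T -> Z) :
    (forall x, \sum_(e <- orbit x) G e <= F x)%R ->
  (\sum_d G d <= \sum_(r | froots f r) F r)%R.
Proof. by move=> le; rewrite sum_froots; apply: ler_sum => r _. Qed.

Lemma sum_ge0 (G : T -> Z) : (forall x, 0 <= \sum_(e <- orbit x) G e)%R -> (0 <= \sum_d G d)%R.
Proof. by move=> le; rewrite sum_froots; apply: sumr_ge0. Qed.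

Lemma sum_constant (R : nmodType) (F : T -> R) :
  (forall x, F (f x) = F x) -> (\sum_d F d = \sum_(r | froots f r) F r *+ order r)%R.
Proof.
move=> Ff; rewrite sum_froots; apply: eq_bigr => r _.
rewrite sum_orbit -[X in (_ *+ X)%R]card_ord -sumr_const; apply: eq_bigr => i _.
by elim: (i : nat) => //= j IH; rewrite Ff.
Qed.

Lemma card_froots : \sum_(r | froots f r) order r = #|T|.
Proof. by rewrite -sum1_card (sum_constant (F := fun=> 1)) //; apply: eq_bigr => r _; rewrite natn. Qed.

End Orbits.

(** * Corner types and corner labels of a map *)

Definition clip (n : nat) : nat := minn n 42.

Lemma clip_le n : clip n <= 42. Proof. exact: geq_minr. Qed.

Lemma clip_in_range n : 3 <= n -> in_range (clip n).
Proof. by rewrite /in_range /clip leq_min geq_minr => ->. Qed.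

Section Corners.
Variables (D : finType) (alpha sigma : {perm D}).

Definition corner_type (d : D) : seq nat :=
  [seq clip (fsize alpha sigma e) | e <- fingraph.orbit sigma d].

Definition corner_label (d : D) : seq nat :=
  [seq tag (clip (fsize alpha sigma e)) (mark (corner_type e) (corner_type (alpha e)))
  | e <- fingraph.orbit sigma d].

Notation phi := (phi alpha sigma).
Notation fs := (fsize alpha sigma).
Notation ct := corner_type.
Notation lb := corner_label.

Lemma size_ct d : size (ct d) = vdeg sigma d.
Proof. by rewrite size_map size_orbit. Qed.

Lemma size_lb d : size (lb d) = vdeg sigma d.
Proof. by rewrite size_map size_orbit. Qed.

Lemma ct_sigma d : ct (sigma d) = rot 1 (ct d).
Proof. by rewrite /ct (orbit_step perm_inj) map_rot. Qed.

Lemma lb_sigma d : lb (sigma d) = rot 1 (lb d).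
Proof. by rewrite /lb (orbit_step perm_inj) map_rot. Qed.

Lemma lb_iter i d : i <= vdeg sigma d -> lb (iter i sigma d) = rot i (lb d).
Proof. by move=> le; rewrite /lb (orbit_iter perm_inj) // map_rot. Qed.

Lemma ct_iter i d : i <= vdeg sigma d -> ct (iter i sigma d) = rot i (ct d).
Proof. by move=> le; rewrite /ct (orbit_iter perm_inj) // map_rot. Qed.

Lemma nth_ct d i : i < vdeg sigma d -> nth 0 (ct d) i = clip (fs (iter i sigma d)).
Proof. by move=> lt; rewrite (nth_map d) ?size_orbit // nth_orbit. Qed.

Lemma sizes_lb d : sizes (lb d) = ct d.
Proof.
by rewrite /sizes -map_comp; apply: eq_map => e /=; rewrite untag_tag ?clip_le.
Qed.

Lemma lb_rec d : exists l, lb d = tag (clip (fs d)) (mark (ct d) (ct (alpha d))) :: l.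
Proof. by rewrite /lb orbit_rec /=; eexists. Qed.

Lemma ct_rec d : exists l, ct d = clip (fs d) :: l.
Proof. by rewrite /ct orbit_rec /=; eexists. Qed.

Lemma tagged_head_lb d : tagged (head 0 (lb d)) = mark (ct d) (ct (alpha d)).
Proof. by have [l ->] := lb_rec d; rewrite /= tagged_tag ?clip_le. Qed.

Lemma untag_head_lb d : untag (head 0 (lb d)) = clip (fs d).
Proof. by have [l ->] := lb_rec d; rewrite /= untag_tag ?clip_le. Qed.

Lemma head_ct d : head 0 (ct d) = clip (fs d).
Proof. by have [l ->] := ct_rec d. Qed.

Lemma lb_neq0 d : lb d != [::].
Proof. by have [l ->] := lb_rec d. Qed.

Hypothesis alphaK : involutive alpha.

Lemma phi_inj : injective phi.
Proof. by move=> x y /perm_inj/perm_inj. Qed.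

Lemma phi_alpha d : phi (alpha d) = sigma d.
Proof. by rewrite /Defs.phi alphaK. Qed.

Lemma fs_phi d : fs (phi d) = fs d.
Proof. exact: (order_step phi_inj). Qed.

Lemma fs_sigma d : fs (sigma d) = fs (alpha d).
Proof. by rewrite -phi_alpha fs_phi. Qed.

Lemma ct_phi d : ct (phi d) = rot 1 (ct (alpha d)). Proof. exact: ct_sigma. Qed.
Lemma lb_phi d : lb (phi d) = rot 1 (lb (alpha d)). Proof. exact: lb_sigma. Qed.

Hypothesis deg3 : forall d, 3 <= vdeg sigma d.

Lemma ct1 d : nth 0 (ct d) 1 = clip (fs (alpha d)).
Proof. by rewrite nth_ct ?fs_sigma //; apply: leq_trans (deg3 d). Qed.

Lemma last_rot1 (x0 : nat) (s : seq nat) : s != [::] -> last x0 (rot 1 s) = head x0 s.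
Proof. by case: s => // x s _; rewrite rot1_cons last_rcons. Qed.

Lemma ct_neq0 d : ct d != [::].
Proof. by have [l ->] := ct_rec d. Qed.

Lemma last_ct_phi d : last 0 (ct (phi d)) = clip (fs (alpha d)).
Proof. by rewrite ct_phi last_rot1 ?ct_neq0 // head_ct. Qed.

Hypothesis noloop : forall d, ~~ fconnect sigma d (alpha d).
Hypothesis nomulti :
  forall d e, fconnect sigma d e -> fconnect sigma (alpha d) (alpha e) -> d = e.

(** A face of size one is a loop. A face of size two consists of parallel edges or is a single edge
    walked twice; in the latter case [sigma d = d], against the minimum degree. *)
Lemma fs_ge3 d : 3 <= fs d.
Proof.
have sc := fconnect_sym (@perm_inj _ sigma).
have ord1 (x : D) : sigma x != x.
  apply/eqP => sx; have := deg3 x; rewrite leqNgt => /negP; apply.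
  have -> : vdeg sigma x = 1; last by [].
  by apply: (@order_cycle _ _ [:: x]); rewrite ?inE //= sx eqxx.
rewrite /fsize; set n := fingraph.order _ _.
have n0 : 0 < n by rewrite /n fingraph.order_gt0.
have it : iter n phi d = d by apply: (iter_order phi_inj).
case: n n0 it => [|[|[|n]]] //= _ it.
- have := noloop d; rewrite sc => /negP; case.
  by rewrite -{2}it; apply: fconnect1.
- have e1 : fconnect sigma d (alpha (phi d)).
    by rewrite sc -{2}it; apply: fconnect1.
  have e2 : fconnect sigma (alpha d) (alpha (alpha (phi d))).
    by rewrite alphaK; apply: fconnect1.
  have de := nomulti e1 e2; case/eqP: (ord1 d).
  by rewrite {1}de -/(phi (phi d)).
Qed.

End Corners.

#[local] Opaque lcm42 part.

(** * The charge of vertices and faces *)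

Definition rat_of_Z (z : Z) : rat := ((int_of_Z z)%:~R)%R.

Lemma rat_of_ZD x y : rat_of_Z (x + y)%coqZ = (rat_of_Z x + rat_of_Z y)%R.
Proof. by rewrite /rat_of_Z -rmorphD /= -rmorphD. Qed.

Lemma rat_of_ZM x y : rat_of_Z (x * y)%coqZ = (rat_of_Z x * rat_of_Z y)%R.
Proof. by rewrite /rat_of_Z -rmorphM /= -rmorphM. Qed.

Lemma rat_of_Z_nat n : rat_of_Z (Z.of_nat n) = (n%:R)%R.
Proof. by rewrite /rat_of_Z; have -> : int_of_Z (Z.of_nat n) = Posz n by lia. Qed.

Lemma rat_of_Z_gt0 z : (0 < rat_of_Z z)%R -> (0 < z)%coqZ.
Proof. rewrite /rat_of_Z ltr0z; lia. Qed.

Lemma rat_of_Z_lt0 z : (0 < z)%coqZ -> (0 < rat_of_Z z)%R.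
Proof. rewrite /rat_of_Z ltr0z; lia. Qed.

(** Clears denominators, so that positivity of the curvature becomes an integer inequality. *)
Lemma scaled_curvature (l p : Z) v : (rat_of_Z l != 0)%R ->
  (rat_of_Z (2 * l - Z.of_nat v * l + 2 * p)%coqZ =
    2%:R * ((1 - v%:R / 2%:R + rat_of_Z p / rat_of_Z l) * rat_of_Z l))%R.
Proof.
move=> l0; have -> : 2%coqZ = Z.of_nat 2 by [].
have -> : (Z.of_nat 2 * l - Z.of_nat v * l + Z.of_nat 2 * p =
  Z.of_nat 2 * l + (-1) * (Z.of_nat v * l) + Z.of_nat 2 * p)%coqZ by lia.
rewrite !rat_of_ZD !rat_of_ZM !rat_of_Z_nat (_ : rat_of_Z (-1)%coqZ = -1)%R //.
by move: (rat_of_Z p) (rat_of_Z l) l0 => p' l' l0; field.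
Qed.

#[local] Opaque rat_of_Z.

Lemma lcm42_gt0 : (0 < rat_of_Z lcm42)%R.
Proof. by apply: rat_of_Z_lt0; vm_compute. Qed.

Lemma part_inv x : in_range x ->
  ((x%:R)^-1 = rat_of_Z (part x) / rat_of_Z lcm42 :> rat)%R.
Proof.
rewrite in_range_iota => xr.
have chk : all (fun x => Z.eqb (Z.of_nat x * part x) lcm42) (iota 3 40) by vm_compute.
have /Z.eqb_eq e := allP chk x xr.
have l0 := lt0r_neq0 lcm42_gt0.
move: l0; move: lcm42 e => l e l0.
have x0 : (x%:R != 0 :> rat)%R by move: xr; rewrite mem_iota pnatr_eq0; lia.
apply: (mulfI x0); rewrite divff //; apply: (mulIf l0).
by rewrite mul1r -mulrA -mulrA mulVf // mulr1 -{1}e rat_of_ZM rat_of_Z_nat.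
Qed.

Lemma sum_foldr (F : nat -> Z) s : foldr (fun i r => F i + r)%coqZ 0%coqZ s = (\sum_(i <- s) F i)%R.
Proof. by elim: s => [|i s IH]; rewrite ?big_nil // big_cons /= IH. Qed.

(** * Final charges of vertices and faces *)

Section Bound.
Variables (D : finType) (alpha sigma : {perm D}).
Notation phi := (phi alpha sigma).
Notation fs := (fsize alpha sigma).
Notation ct := (corner_type alpha sigma).
Notation lb := (corner_label alpha sigma).

Hypothesis alphaK : involutive alpha.
Hypothesis deg3 : forall d, 3 <= vdeg sigma d.
Hypothesis fs3 : forall d, 3 <= fs d.
Hypothesis pos : forall d, (0 < curvature alpha sigma d)%R.

(** Clipping a size at 42 can only increase its reciprocal. *)
Lemma parts_sum_bound d :
  (curvature alpha sigma d <= 1 - (vdeg sigma d)%:R / 2%:R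
     + rat_of_Z (parts_sum (ct d)) / rat_of_Z lcm42)%R.
Proof.
rewrite /curvature lerD2l /ct; elim: (fingraph.orbit sigma d) => [|e s IH] /=.
  by rewrite big_nil (_ : rat_of_Z 0 = 0)%R ?mul0r.
rewrite big_cons -/(parts_sum _) rat_of_ZD mulrDl; apply: lerD => //.
have c3 := clip_in_range (fs3 e).
rewrite -part_inv // lef_pV2 ?posrE ?ltr0n ?ler_nat.
- exact: geq_minl.
- exact: leq_trans (fs3 e).
- by case/andP: c3 => c3 _; apply: leq_trans c3.
Qed.

(** With all faces of size at least three, the curvature at degree v is at most 1 - v/6. *)
Lemma vdeg_le5 d : vdeg sigma d <= 5.
Proof.
rewrite leqNgt; apply/negP => big.
have le3 : (\sum_(e <- fingraph.orbit sigma d) ((fs e)%:R)^-1 <= (vdeg sigma d)%:R / 3%:R :> rat)%R.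
  rewrite /vdeg -size_orbit; elim: (fingraph.orbit sigma d) => [|e s IH] /=.
    by rewrite big_nil mul0r.
  rewrite big_cons -add1n natrD mulrDl; apply: lerD => //.
  by rewrite mul1r lef_pV2 ?posrE ?ltr0n ?ler_nat //; apply: leq_trans (fs3 e).
have := pos d; rewrite /curvature.
have : (6%:R <= (vdeg sigma d)%:R :> rat)%R by rewrite ler_nat.
by move: (\sum_(_ <- _) _)%R ((vdeg sigma d)%:R)%R le3 => a b; lra.
Qed.

Lemma ct_mem d : ct d \in corner_tuples (clip (fs d)).
Proof.
rewrite -head_ct; apply: mem_corner_tuples.
- by apply/allP => x /mapP[e _ ->]; apply: clip_in_range.
- by rewrite size_ct deg3 vdeg_le5.
rewrite size_ct.
have := lt_le_trans (pos d) (parts_sum_bound d).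
have l0 := lcm42_gt0.
rewrite -(pmulr_lgt0 _ l0) -(pmulr_rgt0 _ (ltr0Sn _ 1)) -scaled_curvature; last first.
  exact: lt0r_neq0.
move/rat_of_Z_gt0.
(* [part 2] is one half in units of 1/[lcm42], which matches the threshold used in the
   enumeration. *)
have -> : lcm42 = (2 * part 2)%coqZ by vm_compute.
by move: (part 2) (parts_sum _) (vdeg _ _) => a b v; nia.
Qed.

Lemma lb_mem d : lb d \in labels (clip (fs d)).
Proof.
rewrite -head_ct.
have -> : lb d = [seq tag p.1 p.2 | p <- zip (ct d)
    [seq mark (ct e) (ct (alpha e)) | e <- fingraph.orbit sigma d]].
  by rewrite {1}/corner_type zip_map -map_comp.
apply: mem_labels; first by rewrite head_ct ct_mem.
  by rewrite !size_map.
move=> i; rewrite size_ct => lt; rewrite (nth_map d) ?size_orbit // => /andP[+ _].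
by rewrite nth_orbit // ct_iter // ltnW.
Qed.

Hypothesis joined_ok : forall d, joined_sizes (ct d) (ct (alpha d)).

Lemma joined_lb d : joined (lb d) (lb (phi d)).
Proof.
rewrite /joined !sizes_lb ct_phi rotK; apply/and4P; split=> //.
- by rewrite ct1 // -last_ct_phi // ct_phi.
- by rewrite tagged_head_lb.
- by rewrite lb_phi last_rot1 ?lb_neq0 // tagged_head_lb alphaK.
Qed.

(** The cost of the arc from the corner of [d] to that of [phi d]. Counting each corner on arrival
    changes nothing around a closed walk. *)
Definition dart_charge (d : D) : Z :=
  (corner_charge (lb (phi d)) + edge_charge (lb d) (lb (alpha d)))%coqZ.

Lemma dart_charge_large d : 41 < fs d -> dart_charge d = 0%coqZ.
Proof.
move=> large; have c42 : clip (fs d) = 42 by apply/minn_idPr.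
rewrite /dart_charge corner_charge_large ?lb_neq0 ?untag_head_lb ?fs_phi //.
by rewrite edge_charge_large // untag_head_lb.
Qed.

Lemma dart_arc d : fs d <= 41 ->
  (label_index (fs d) (lb (phi d)), dart_charge d)
    \in arcs (walk_graph (fs d)) (label_index (fs d) (lb d)).
Proof.
move=> small.
have ck x : fs x = fs d -> clip (fs x) = fs d by move=> ->; apply/minn_idPl; apply: leqW.
have mem x : fs x = fs d -> lb x \in labels (fs d) by move=> fx; rewrite -(ck x fx) lb_mem.
rewrite /dart_charge -[lb (alpha d)](rotK 1) -lb_phi; apply: walk_graph_arc.
- exact: leqW.
- exact: mem.
- by apply: mem; rewrite fs_phi.
- by rewrite untag_head_lb ck // fs_phi.
- by rewrite sizes_lb ct1 // ltnS clip_le.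
- exact: joined_lb.
Qed.

Lemma face_charge d : (0 <= \sum_(e <- fingraph.orbit phi d) dart_charge e)%R.
Proof.
rewrite (sum_orbit _ dart_charge).
have fs_iter i : fs (iter i phi d) = fs d by elim: i => //= i <-; rewrite fs_phi.
case: (leqP (fs d) 41) => [small|large]; last first.
  by apply: sumr_ge0 => i _; rewrite dart_charge_large // fs_iter.
have bounds : 3 <= fs d <= 41 by rewrite fs3 small.
have per := iter_periodic (@phi_inj _ alpha sigma).
have := @no_negative_cycleP (walk_graph (fs d)) (fs d)
  (fun i => label_index (fs d) (lb (iter i phi d))) (fun i => dart_charge (iter i phi d)).
apply.
- exact: leq_trans (fs3 d).
- exact: faces_ok bounds.
- by move=> i; rewrite per.
- by move=> i; rewrite per.
by move=> i; have := @dart_arc (iter i phi d); rewrite fs_iter => /(_ small).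
Qed.

Lemma vertex_charge d :
  (\sum_(e <- fingraph.orbit sigma d) corner_charge (lb e) <= curv (ct d) - target)%R.
Proof.
rewrite (sum_orbit _ (fun e => corner_charge (lb e))).
have := vertices_ok (clip_in_range (fs3 d)) (lb_mem d).
rewrite /vertex_ok sizes_lb size_lb sum_foldr -{1}[vdeg sigma d]subn0 big_mkord.
rewrite (eq_bigr (fun i : 'I_(vdeg sigma d) => corner_charge (lb (iter i sigma d)))).
  exact: id.
by move=> i _; rewrite lb_iter // ltnW.
Qed.

(** Summing over all faces, the edge charges cancel: reversing every dart changes the sign of their
    sum. *)
Lemma total_corner_charge : (0 <= \sum_d corner_charge (lb d))%R.
Proof.
have := sum_ge0 (phi_inj (sigma := sigma)) face_charge.
have re : (\sum_d corner_charge (lb (phi d)) = \sum_d corner_charge (lb d))%R.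
  by rewrite [RHS](reindex_inj (@phi_inj _ alpha sigma)).
rewrite /dart_charge big_split /= re.
suff -> : (\sum_d edge_charge (lb d) (lb (alpha d)) = 0)%R by rewrite addr0.
set s := (\sum_d _)%R.
have e : (s = - s)%R.
  rewrite {1}/s (reindex_inj (@perm_inj _ alpha)) /= -sumrN.
  by apply: eq_bigr => d _; rewrite alphaK edge_chargeC.
by move: e; move: (s : Z) => z e; lia.
Qed.

End Bound.

(** * Euler's formula *)

Lemma card_froots_fcard (T : finType) (f : T -> T) : fcard f T = \sum_(r | froots f r) 1.
Proof. by rewrite sum1_card; apply: eq_card => x; rewrite !inE andbT. Qed.

Lemma microE : micro = 1000000%coqZ. Proof. by []. Qed.
Lemma half_micro : micro = (2 * (micro / 2))%coqZ. Proof. by []. Qed.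
Lemma recip_small s : s < 42 -> recip s = (micro / Z.of_nat s)%coqZ.
Proof. by rewrite /recip => ->. Qed.
Lemma recip_large s : 42 <= s -> recip s = 0%coqZ.
Proof. by move=> ge; rewrite /recip (leq_gtF ge). Qed.
Lemma targetE : target = 9570%coqZ. Proof. by []. Qed.
Lemma curvE t : curv t =
  (micro - (micro / 2) * Z.of_nat (size t) + foldr (fun s r => recip s + r) 0 t)%coqZ.
Proof. by []. Qed.
#[local] Opaque micro target recip curv corner_charge Z.div.

Lemma mulrn_Z (z : Z) n : (z *+ n)%R = (z * Z.of_nat n)%coqZ.
Proof. by elim: n => [|n IH]; rewrite ?mulr0n ?mulrS ?IH /GRing.add /=; lia. Qed.

Section Euler.
Variables (D : finType) (alpha sigma : {perm D}).
Notation phi := (phi alpha sigma).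
Notation fs := (fsize alpha sigma).
Notation ct := (corner_type alpha sigma).
Notation lb := (corner_label alpha sigma).

Hypothesis alphaK : involutive alpha.
Hypothesis alpha_neq : forall d, alpha d != d.

Lemma card_darts_edges : #|D| = 2 * nedges alpha.
Proof.
rewrite /nedges card_froots_fcard -(card_froots (@perm_inj _ alpha)) big_distrr /=.
apply: eq_bigr => d _; rewrite muln1.
by apply: (@order_cycle _ _ [:: d; alpha d]); rewrite /= ?inE ?eqxx // ?alphaK ?eqxx // eq_sym alpha_neq.
Qed.

(** Reciprocals are rounded down, so the corners of a face weigh at most one unit together. *)
Lemma recip_le d : (recip (clip (fs d)) *+ fs d <= micro)%R.
Proof.
rewrite mulrn_Z; case: (ltnP (fs d) 42) => [lt|ge]; last first.
  by rewrite recip_large ?microE // /clip leq_min ge.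
rewrite recip_small /clip ?gtn_min ?lt // (minn_idPl (ltnW lt)).
have : 0 < fs d by apply: fingraph.order_gt0.
move: (fs d) => n n0; have := Z.mul_div_le micro (Z.of_nat n).
by move: (Z.div _ _) => q; lia.
Qed.

Lemma curv_ct d : curv (ct d) =
  (micro - (micro / 2) * Z.of_nat (vdeg sigma d) +
    \sum_(e <- fingraph.orbit sigma d) recip (clip (fs e)))%coqZ%R.
Proof.
rewrite curvE size_ct; congr (_ + _)%R; rewrite /corner_type.
by elim: fingraph.orbit => [|e s IH] /=; rewrite ?big_nil // big_cons IH.
Qed.

Hypothesis euler : nverts sigma + nfaces alpha sigma = nedges alpha + 2.

(** Combinatorial Gauss-Bonnet: vertices count one, each dart minus one half, hence each edge minus
    one, and faces at most one. *)
Lemma sum_curv : (\sum_(r | froots sigma r) curv (ct r) <= 2 * micro)%coqZ%R.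
Proof.
under eq_bigr do rewrite curv_ct.
rewrite big_split /= -(sum_froots (@perm_inj _ sigma)).
have faces : (\sum_d recip (clip (fs d)) <= micro *+ nfaces alpha sigma)%R.
  rewrite (sum_constant (@phi_inj _ alpha sigma)) => [|d]; last by rewrite fs_phi.
  rewrite /nfaces card_froots_fcard -sumrMnr; apply: ler_sum => r _.
  exact: recip_le.
have verts : (\sum_(r | froots sigma r) (micro - micro / 2 * Z.of_nat (vdeg sigma r))%coqZ
    = micro *+ nverts sigma - (micro / 2)%coqZ *+ #|D|)%R.
  rewrite -(card_froots (@perm_inj _ sigma)) /nverts card_froots_fcard -!sumrMnr -sumrB.
  by apply: eq_bigr => r _; rewrite mulr1n mulrn_Z.
rewrite verts card_darts_edges; move: faces euler; rewrite !mulrn_Z.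
move: (\sum_d _)%R (nverts _) (nfaces _ _) (nedges _) half_micro.
move: micro (Z.div _ _) => m h s v f e mh faces eu.
have {faces}faces : (s <= m * Z.of_nat f)%coqZ by exact/Z.leb_le.
change (m * Z.of_nat v - h * Z.of_nat (2 * e) + s <= 2 * m)%coqZ.
have -> : Z.of_nat v = (Z.of_nat e + 2 - Z.of_nat f)%coqZ by lia.
have -> : Z.of_nat (2 * e) = (2 * Z.of_nat e)%coqZ by lia.
by move: faces; rewrite mh; move: (Z.of_nat e) (Z.of_nat f) => ze zf; lia.
Qed.

Hypothesis vertex_charge : forall d,
  (\sum_(e <- fingraph.orbit sigma d) corner_charge (lb e) <= curv (ct d) - target)%R.
Hypothesis total_charge : (0 <= \sum_d corner_charge (lb d))%R.

(** The total charge gives 9570 V <= 2000000, whereas 9570 * 209 = 2000130. *)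
Lemma nverts_le208 : nverts sigma <= 208.
Proof.
have := sum_froots_le (@perm_inj _ sigma) vertex_charge; rewrite sumrB.
have -> : (\sum_(r | froots sigma r) target = target *+ nverts sigma)%R.
  by rewrite /nverts card_froots_fcard -sumrMnr; apply: eq_bigr => r _; rewrite mulr1n.
have := sum_curv; rewrite mulrn_Z => le1 le2.
have := le_trans total_charge le2; move: le1; rewrite microE targetE.
move: (\sum_(_ | _) _)%R (nverts sigma) => c n le1 /Z.leb_le le3.
have {}le3 : (0 <= c - 9570 * Z.of_nat n)%coqZ by exact: le3.
lia.
Qed.

End Euler.

(** * Prisms and antiprisms *)

(** Read off the enumeration, where a large face still counts 1/42. The listed types of degree three
    are excluded later by [no_double_large]. *)
Lemma corner_tuples3 t : t \in corner_tuples 3 ->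
  [&& (nth 0 t 1 == 42) ==> (last 0 t != 42),
      (nth 0 t 1 == 42) && (last 0 t == 3) ==> (t \in [:: [:: 3; 42; 3]; [:: 3; 42; 3; 3]])
    & (nth 0 t 1 == 3) && (last 0 t == 42) ==> (t \in [:: [:: 3; 3; 42]; [:: 3; 3; 3; 42]])].
Proof. by move: t; apply/allP; vm_compute. Qed.

Lemma corner_tuples4 t : t \in corner_tuples 4 ->
  ((last 0 t == 42) ==> (t \in [:: [:: 4; 3; 42]; [:: 4; 4; 42]])) &&
  ((nth 0 t 1 == 42) ==> (t \in [:: [:: 4; 42; 3]; [:: 4; 42; 4]])).
Proof. by move: t; apply/allP; vm_compute. Qed.

Lemma iter_order_le (T : finType) (f : T -> T) x n : 0 < n -> iter n f x = x ->
  fingraph.order f x <= n.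
Proof.
move=> n0 it; rewrite leqNgt; apply/negP => lt.
have := findex_iter lt; rewrite it -{2}[x]/(iter 0 f x) findex_iter ?fingraph.order_gt0 //.
by move=> e; rewrite -e in n0.
Qed.

Lemma perm_eq_two (T : eqType) (a b : T) (s : seq T) : a != b ->
  all (fun x => (x == a) || (x == b)) s ->
  perm_eq s (nseq (count_mem a s) a ++ nseq (count_mem b s) b).
Proof.
move=> ab al; apply/seq.permP => p; rewrite count_cat !count_nseq.
elim: s al => [|x s IH] /=; first by rewrite !muln0.
case/andP=> xab /IH ->; rewrite !mulnDr; case/orP: xab => /eqP ->.
  by rewrite eqxx (negPf ab) muln1 muln0 add0n addnA.
by rewrite eqxx eq_sym (negPf ab) muln1 muln0 add0n addnCA.
Qed.

(** * Tools common to prisms and antiprisms *)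

Section Ladders.
Variables (D : finType) (alpha sigma : {perm D}).
Notation phi := (phi alpha sigma).
Notation fs := (fsize alpha sigma).
Notation ct := (corner_type alpha sigma).

Hypothesis alphaK : involutive alpha.
Hypothesis deg3 : forall d, 3 <= vdeg sigma d.
Hypothesis ct_in : forall d, ct d \in corner_tuples (clip (fs d)).
Hypothesis conn :
  forall d e, connect [rel x y | (y == sigma x) || (y == alpha x)] d e.

Lemma conn_ind (P : D -> Prop) d : P d -> (forall x, P x -> P (sigma x)) ->
  (forall x, P x -> P (alpha x)) -> forall e, P e.
Proof.
move=> Pd Ps Pa e; have /connectP[p pth ->] := conn d e.
elim: p d Pd pth => //= x p IH d Pd /andP[/orP[] /eqP -> pth]; apply: IH pth.
  exact: Ps.
exact: Pa.
Qed.

Lemma iter_vdeg d n : size (ct d) = n -> iter n sigma d = d.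
Proof. by rewrite size_ct => <-; apply: (iter_order (@perm_inj _ sigma)). Qed.

Lemma clip_small n k : k < 42 -> clip n = k -> n = k.
Proof. by rewrite /clip; lia. Qed.

Lemma fs_head d k l : k < 42 -> ct d = k :: l -> fs d = k.
Proof. by move=> k42 e; apply: (clip_small k42); rewrite -head_ct e. Qed.

Lemma iter_fs d n : fs d = n -> iter n phi d = d.
Proof. by move=> <-; apply: (iter_order (@phi_inj _ alpha sigma)). Qed.

Lemma ct_alpha d : ct (alpha d) = rotr 1 (ct (phi d)).
Proof. by rewrite ct_phi rotK. Qed.

Lemma last_ct_phi1 d : last 0 (ct (phi d)) = nth 0 (ct d) 1.
Proof. by rewrite last_ct_phi ct1. Qed.

(** Two sides of a triangle cannot both border large faces: at their common vertex the curvature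
    would not be positive. *)
Lemma no_double_large d : fs d = 3 -> nth 0 (ct (phi d)) 1 = 42 -> last 0 (ct d) = 42 -> False.
Proof.
move=> f3 n1 l; have := ct_in (phi (phi d)); rewrite !fs_phi f3 => /corner_tuples3 /and3P[+ _ _].
rewrite last_ct_phi1 n1 eqxx implybF => /eqP; apply.
by rewrite -last_ct_phi1 -[phi (phi (phi d))]/(iter 3 phi d) iter_fs.
Qed.

(* [psi] matches two face walks that run in opposite directions. *)
Lemma mirror_size (P : pred D) (psi : D -> D) :
    (forall x, P x -> P (phi x)) -> (forall x, P x -> P (psi x)) ->
    (forall x, P x -> phi (psi (phi x)) = psi x) -> (forall x, P x -> psi (psi x) = x) ->
  forall x, P x -> fs (psi x) = fs x.
Proof.
move=> Pphi Ppsi flip inv.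
have iterP x i : P x -> P (iter i phi x) by move=> Px; elim: i => //= i; apply: Pphi.
have flips x i : P x -> iter i phi (psi (iter i phi x)) = psi x.
  move=> Px; elim: i => //= i IH.
  by rewrite -iterS iterSr flip ?IH //; apply: iterP.
(* After one full turn around the face of [x], [flips] says that [psi x] has come back as well. *)
have le x : P x -> fs (psi x) <= fs x.
  move=> Px; apply: iter_order_le; first exact: fingraph.order_gt0.
  by have := flips x (fs x) Px; rewrite (iter_fs erefl).
move=> x Px; apply/eqP; rewrite eqn_leq le //=.
by rewrite -{1}(inv _ Px) le // Ppsi.
Qed.

(** Corners of each size are counted around vertices ([sumG]) and around faces ([sumF]). Euler's
    formula will then determine the number of faces of size [N]. *)
Lemma ring_count N s m :
    s < N -> (forall d, perm_eq (corner_sizes alpha sigma d) (N :: nseq m s)) ->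
  [/\ #|D| = m.+1 * nverts sigma,
      nverts sigma = N * count_mem N (face_sizes alpha sigma),
      m * nverts sigma = s * count_mem s (face_sizes alpha sigma),
      nfaces alpha sigma =
        count_mem N (face_sizes alpha sigma) + count_mem s (face_sizes alpha sigma)
    & perm_eq (face_sizes alpha sigma)
        (nseq (count_mem N (face_sizes alpha sigma)) N ++
         nseq (count_mem s (face_sizes alpha sigma)) s)].
Proof.
move=> sN cs.
have Ns : N != s by rewrite gtn_eqF.
have mem d : (fs d == N) || (fs d == s).
  have : fs d \in corner_sizes alpha sigma d.
    by rewrite /corner_sizes orbit_rec /= mem_head.
  by rewrite (perm_mem (cs d)) inE mem_nseq => /orP[->//|/andP[_ ->]]; rewrite orbT.
have sumG (G : nat -> nat) : \sum_d G (fs d) = (G N + m * G s) * nverts sigma.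
  rewrite (sum_froots (@perm_inj _ sigma)) /nverts card_froots_fcard big_distrr /=.
  apply: eq_bigr => r _; rewrite muln1.
  have -> : \sum_(e <- fingraph.orbit sigma r) G (fs e) = \sum_(x <- corner_sizes alpha sigma r) G x.
    by rewrite big_map.
  by rewrite (perm_big _ (cs r)) big_cons big_nseq iter_addn_0 mulnC.
have sumF (G : nat -> nat) : \sum_d G (fs d) = \sum_(x <- face_sizes alpha sigma) x * G x.
  rewrite (sum_constant (@phi_inj _ alpha sigma)) => [|d]; last by rewrite fs_phi.
  rewrite /face_sizes big_map big_enum /=; apply: eq_big => [r|r _] //.
  by rewrite -mulr_natr natn mulnC.
have count k : \sum_(x <- face_sizes alpha sigma) x * (x == k) = k * count_mem k (face_sizes alpha sigma).
  elim: (face_sizes _ _) => [|x l IH]; first by rewrite big_nil muln0.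
  by rewrite big_cons IH /= mulnDr; case: eqP => [->|_]; rewrite ?muln1 ?muln0.
have al : all (fun x => (x == N) || (x == s)) (face_sizes alpha sigma).
  by apply/allP => x /mapP[d _ ->].
have pe := perm_eq_two Ns al; split=> //.
- have := sumG (fun=> 1); rewrite sum1_card => ->; lia.
- pose G x := nat_of_bool (x == N); have := sumG G; rewrite (sumF G) count.
  by rewrite /G eqxx eq_sym (negPf Ns) muln0 addn0 mul1n.
- pose G x := nat_of_bool (x == s); have := sumG G; rewrite (sumF G) count.
  by rewrite /G eqxx (negPf Ns) muln1 add0n.
- have := perm_size pe; rewrite size_cat !size_nseq => <-.
  by rewrite /face_sizes size_map -cardE /nfaces; apply: eq_card => r; rewrite !inE andbT.
Qed.

End Ladders.

(** * Ladders of squares and prisms *)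

Section Prism.
Variables (D : finType) (alpha sigma : {perm D}).
Notation phi := (phi alpha sigma).
Notation fs := (fsize alpha sigma).
Notation ct := (corner_type alpha sigma).

Hypothesis alphaK : involutive alpha.
Hypothesis deg3 : forall d, 3 <= vdeg sigma d.
Hypothesis ct_in : forall d, ct d \in corner_tuples (clip (fs d)).
Hypothesis conn :
  forall d e, connect [rel x y | (y == sigma x) || (y == alpha x)] d e.
Hypothesis euler : nverts sigma + nfaces alpha sigma = nedges alpha + 2.
Hypothesis alpha_neq : forall d, alpha d != d.

(** [d] is a rung of a ladder of squares between two large faces. *)
Definition rung d := (ct d == [:: 4; 4; 42]) && (ct (phi d) == [:: 4; 42; 4]).

Let phi4 d : fs d = 4 -> phi (phi (phi (phi d))) = d.
Proof. exact: (@iter_fs _ _ _ d 4). Qed.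

Let sigma3 d : size (ct d) = 3 -> sigma (sigma (sigma d)) = d.
Proof. exact: (@iter_vdeg _ _ _ d 3). Qed.

(** The enumeration leaves only a square or a triangle across the edge of [d], and a triangle there
    would border two large faces. *)
Lemma opposite_large d : fs d = 4 -> last 0 (ct d) = 42 -> nth 0 (ct (phi d)) 1 = 42 -> rung d.
Proof.
move=> f4 l42 n42.
have := ct_in d; rewrite f4 => /corner_tuples4; rewrite l42 /= => /andP[td _].
have := ct_in (phi d); rewrite fs_phi f4 => /corner_tuples4 /andP[_]; rewrite n42 /= => tp.
have := last_ct_phi1 alphaK deg3 d; move: td tp; rewrite !inE /rung.
case/orP=> /eqP ed; case/orP=> /eqP ep; rewrite ed ep //= => _.
case: (@no_double_large _ _ _ alphaK deg3 ct_in (alpha d)).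
- have := @ct1 _ _ _ alphaK deg3 d; rewrite ed /= => /esym; exact: clip_small.
- by rewrite phi_alpha // ct_sigma ed.
- by rewrite ct_alpha ep.
Qed.

Lemma rung_alpha d : rung d -> rung (alpha d).
Proof.
by case/andP=> /eqP e1 /eqP e2; rewrite /rung ct_alpha e2 phi_alpha // ct_sigma e1.
Qed.

Lemma rung_opposite d : rung d -> rung (phi (phi d)).
Proof.
case/andP=> /eqP e1 /eqP e2; have f4 : fs d = 4 by apply: fs_head e1.
have p4 := phi4 f4; apply: opposite_large; rewrite ?fs_phi //.
  by rewrite last_ct_phi1 // e2.
by rewrite -last_ct_phi1 // p4 e1.
Qed.

Lemma rung_sigma3 d : rung d -> sigma (sigma (sigma d)) = d.
Proof. by case/andP=> /eqP e _; apply: sigma3; rewrite e. Qed.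

Let on_rung e := [|| rung e, rung (sigma e) | rung (sigma (sigma e))].

(** The ladder propagates: the darts at the ends of rungs are closed under [sigma] and [alpha], so
    by connectivity they are all the darts. *)
Lemma on_rung_all d : rung d -> forall e, on_rung e.
Proof.
move=> rd; apply: (@conn_ind _ _ _ conn on_rung d); rewrite /on_rung ?rd // => e.
  case/or3P=> r.
  - by rewrite (rung_sigma3 r) r !orbT.
  - by rewrite r.
  - by rewrite r orbT.
case/or3P=> r.
- by rewrite rung_alpha.
(* Here [e] runs along a large face, and [alpha e] lies on the square of the rung [sigma e], next to
   the opposite rung. *)
- have f4 : fs (sigma e) = 4 by case/andP: r => /eqP /fs_head ->.
  have r' := rung_alpha (rung_opposite r).
  have -> : alpha e = sigma (alpha (phi (phi (sigma e)))).
    by apply: (@phi_inj _ alpha sigma); rewrite phi_alpha // -{1}(phi4 f4).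
  by rewrite (rung_sigma3 r') r' !orbT.
- have e3 : sigma (sigma (sigma e)) = e.
    by apply: (@perm_inj _ sigma); apply: (@perm_inj _ sigma); apply: rung_sigma3 r.
  have := rung_opposite (rung_alpha r); rewrite phi_alpha // e3 => r'.
  by rewrite -[sigma (alpha e)]/(phi e) r' orbT.
Qed.

Hypothesis all_on_rung : forall e, on_rung e.

Let s3 e : sigma (sigma (sigma e)) = e.
Proof.
case/or3P: (all_on_rung e) => r; first exact: rung_sigma3.
  by apply: (@perm_inj _ sigma); apply: rung_sigma3.
by apply: (@perm_inj _ sigma); apply: (@perm_inj _ sigma); apply: rung_sigma3.
Qed.

Lemma prism_types e : [\/ rung e, ct e = [:: 42; 4; 4] /\ rung (sigma e)
                         | ct e = [:: 4; 42; 4] /\ rung (sigma (sigma e))].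
Proof.
case/or3P: (all_on_rung e) => r; first by constructor 1.
  constructor 2; split=> //; case/andP: r => /eqP + _; rewrite ct_sigma.
  by move/(congr1 (rotr 1)); rewrite rotK.
constructor 3; split=> //; case/andP: r => /eqP + _; rewrite !ct_sigma.
by move/(congr1 (rotr 1 \o rotr 1)); rewrite /= !rotK.
Qed.

Let large d := ct d == [:: 42; 4; 4].
(* The large corner at the other end of the rung at [d]. *)
Let psi d := sigma (sigma (alpha (sigma d))).

Lemma large_rung d : large d -> rung (sigma d).
Proof. by move/eqP => l; case: (prism_types d) => [/andP[/eqP]|[]|[]]; rewrite l. Qed.

Lemma large_of_rung d : rung d -> large (sigma (sigma d)).
Proof. by case/andP=> /eqP e _; rewrite /large !ct_sigma e. Qed.

Lemma prism_large_phi d : large d -> large (phi d).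
Proof.
move=> ld; have f42 : clip (fs (phi d)) = 42 by rewrite fs_phi -head_ct (eqP ld).
by case: (prism_types (phi d)) f42 => [/andP[/eqP e _]|[e _]|[e _]];
  rewrite -head_ct e // /large e.
Qed.

Lemma prism_large_psi d : large d -> large (psi d).
Proof. by move=> ld; apply: large_of_rung; apply: rung_alpha; apply: large_rung. Qed.

Lemma prism_psi_flip d : large d -> phi (psi (phi d)) = psi d.
Proof.
move=> /large_rung r; have f4 : fs (sigma d) = 4 by case/andP: r => /eqP /fs_head ->.
have ad : alpha d = phi (phi (phi (sigma d))).
  by apply: (@phi_inj _ alpha sigma); rewrite phi4 // phi_alpha.
rewrite /psi -[phi d]/(sigma (alpha d)) ad -[in LHS]/(sigma (alpha (phi (phi (sigma d))))) s3.
by rewrite alphaK -[phi (phi (sigma d))]/(sigma (alpha (phi (sigma d)))) s3 /Defs.phi alphaK.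
Qed.

Lemma prism_psiK d : large d -> psi (psi d) = d.
Proof. by move=> _; rewrite /psi s3 alphaK s3. Qed.

Lemma prism_fs_psi d : large d -> fs (psi d) = fs d.
Proof.
exact: (@mirror_size _ alpha sigma large psi prism_large_phi prism_large_psi prism_psi_flip prism_psiK).
Qed.

(** Each vertex has one large corner. Along an edge its size is preserved, either because both
    corners lie on one face or, across a rung, by [psi]. *)
Lemma prism_fs_constant d e : large d -> large e -> fs e = fs d.
Proof.
move=> ld; set N := fs d.
pose Q x := forall y, y \in [:: x; sigma x; sigma (sigma x)] -> large y -> fs y = N.
suff allQ x : Q x by move=> le; apply: (allQ e); rewrite ?mem_head.
apply: (@conn_ind _ _ _ conn Q d).
- move=> y; rewrite !inE => /or3P[] /eqP -> //; rewrite /large ?ct_sigma (eqP ld) //.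
- move=> {}x Qx y; rewrite s3 => yin; apply: Qx; move: yin; rewrite !inE.
  by case/or3P=> ->; rewrite ?orbT.
move=> {}x Qx y yin ly; case: (prism_types x) => [r|[ex rs]|[ex rss]].
- have lx := large_of_rung r; rewrite -(Qx (sigma (sigma x))) ?inE ?eqxx ?orbT //.
  rewrite -(prism_fs_psi lx) /psi s3; congr fs.
  have /andP[/eqP ea _] := rung_alpha r.
  by move: yin ly; rewrite !inE => /or3P[] /eqP -> //; rewrite /large ?ct_sigma ea.
- have lp : large (phi x) by apply: prism_large_phi; apply/eqP.
  have ea : ct (alpha x) = [:: 4; 42; 4] by rewrite ct_alpha (eqP lp).
  rewrite -(Qx x) ?inE ?eqxx //; last by rewrite /large ex.
  rewrite -(fs_phi _ _ x); congr fs; rewrite -[phi x]/(sigma (alpha x)).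
  by move: yin ly; rewrite !inE => /or3P[] /eqP -> //; rewrite /large ?ct_sigma ea.
have la : large (alpha x).
  have := ct1 alphaK deg3 x; rewrite ex /= => f42.
  by case: (prism_types (alpha x)) (head_ct alpha sigma (alpha x)) => [/andP[/eqP e1 _]|[e1 _]|[e1 _]];
    rewrite e1 -f42 // /large e1.
have ls : large (sigma x) by rewrite /large ct_sigma ex.
rewrite -(Qx (sigma x)) ?inE ?eqxx ?orbT // -(@phi_alpha _ _ sigma alphaK x) fs_phi; congr fs.
by move: yin ly; rewrite !inE => /or3P[] /eqP -> //; rewrite /large ?ct_sigma (eqP la).
Qed.

Lemma all_on_rung_prism : D -> is_prism alpha sigma.
Proof.
move=> d0.
have [d ld] : exists d, large d.
  case: (prism_types d0) => [r|[e _]|[e _]].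
  - by exists (sigma (sigma d0)); apply: large_of_rung.
  - by exists d0; apply/eqP.
  - by exists (sigma d0); rewrite /large ct_sigma e.
set N := fs d.
have N42 : 42 <= N.
  by have := head_ct alpha sigma d; rewrite (eqP ld) /= /clip -/N; lia.
have fsN e : fs e = if large e then N else 4.
  case: ifP => [le|]; first exact: prism_fs_constant.
  rewrite /large; case: (prism_types e) => [/andP[/eqP e1 _]|[e1 _]|[e1 _]]; rewrite e1 //= => _;
    exact: fs_head e1.
have cs e : perm_eq (corner_sizes alpha sigma e) (N :: nseq 2 4).
  have orb : fingraph.orbit sigma e = [:: e; sigma e; sigma (sigma e)].
    have o3 : fingraph.order sigma e = 3.
      have := size_ct alpha sigma e; rewrite /vdeg => <-.
      by case: (prism_types e) => [/andP[/eqP -> _]|[-> _]|[-> _]].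
    by rewrite /fingraph.orbit o3.
  rewrite /corner_sizes orb /= !fsN /large !ct_sigma; apply/seq.permP => p.
  by case: (prism_types e) => [/andP[/eqP -> _]|[-> _]|[-> _]] /=; lia.
have [] := @ring_count _ alpha sigma N 4 2 _ cs; first by lia.
rewrite (card_darts_edges alphaK alpha_neq) => eD eV e2V eF pF.
exists N; split.
- lia.
- nia.
(* There are 3V/2 edges and V/2 squares, so Euler's formula leaves exactly two faces of size [N]. *)
- have c2 : count_mem N (face_sizes alpha sigma) = 2 by nia.
  have c4 : count_mem 4 (face_sizes alpha sigma) = N by nia.
  by move: pF; rewrite c2 c4.
- by move=> e; apply: perm_trans (cs e) _; apply/seq.permP => p /=; lia.
Qed.

End Prism.

(** * Strips of triangles and antiprisms *)

Section Antiprism.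
Variables (D : finType) (alpha sigma : {perm D}).
Notation phi := (phi alpha sigma).
Notation fs := (fsize alpha sigma).
Notation ct := (corner_type alpha sigma).

Hypothesis alphaK : involutive alpha.
Hypothesis deg3 : forall d, 3 <= vdeg sigma d.
Hypothesis ct_in : forall d, ct d \in corner_tuples (clip (fs d)).
Hypothesis conn :
  forall d e, connect [rel x y | (y == sigma x) || (y == alpha x)] d e.
Hypothesis euler : nverts sigma + nfaces alpha sigma = nedges alpha + 2.
Hypothesis alpha_neq : forall d, alpha d != d.

(** In a strip of triangles between two large faces, [d] is an inner edge. The
    triangle of the dart [d] has its side on the large face at the tail of [d]
    if [d] is a zig, and on the other large face if [d] is a zag. *)
Definition zig d := (ct d == [:: 3; 3; 3; 42]) && (ct (alpha d) == [:: 3; 3; 3; 42]).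
Definition zag d := (ct d == [:: 3; 3; 42; 3]) && (ct (alpha d) == [:: 3; 3; 42; 3]).

Let phi3 d : fs d = 3 -> phi (phi (phi d)) = d.
Proof. exact: (@iter_fs _ _ _ d 3). Qed.

Let sigma4 d : size (ct d) = 4 -> sigma (sigma (sigma (sigma d))) = d.
Proof. exact: (@iter_vdeg _ _ _ d 4). Qed.

Let phiE d : phi d = sigma (alpha d). Proof. by []. Qed.
Let phia d : phi (alpha d) = sigma d. Proof. exact: phi_alpha. Qed.

Lemma zig_alpha d : zig d -> zig (alpha d).
Proof. by rewrite /zig alphaK andbC. Qed.

Lemma zag_alpha d : zag d -> zag (alpha d).
Proof. by rewrite /zag alphaK andbC. Qed.

(** The third corner of the triangle lies between a large face and a triangle. If its vertex had
    degree three, the next triangle would border two large faces. *)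
Lemma zig_phi d : zig d -> zag (phi d).
Proof.
case/andP=> /eqP e1 /eqP e2; have f3 : fs d = 3 by apply: fs_head e1.
have ep : ct (phi d) = [:: 3; 3; 42; 3] by rewrite ct_phi e2.
have := ct_in (phi (phi d)); rewrite !fs_phi f3 => /corner_tuples3 /and3P[_ + _].
rewrite last_ct_phi1 // ep -last_ct_phi1 // phi3 // e1 /= !inE => /orP[] /eqP e3; last first.
  by rewrite /zag ep ct_alpha e3.
have ey : ct (alpha (phi d)) = [:: 3; 3; 42] by rewrite ct_alpha e3.
case: (@no_double_large _ _ _ alphaK deg3 ct_in (alpha (phi d))).
- exact: fs_head ey.
- by rewrite phia ct_sigma ep.
- by rewrite ey.
Qed.

(** The same argument on the triangle of [alpha d]: the zig is the reverse of that triangle's third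
    side. *)
Lemma zag_turn d : zag d -> zig (sigma (sigma (sigma (alpha d)))).
Proof.
case/andP=> /eqP e1 /eqP e2; set y := alpha d in e2 *.
have s4 : sigma (sigma (sigma (sigma y))) = y by apply: sigma4; rewrite e2.
set a := sigma (sigma (sigma y)).
have ea : ct a = [:: 3; 3; 3; 42] by rewrite !ct_sigma e2.
have f3 : fs y = 3 by apply: fs_head e2.
have az : alpha a = phi (phi y).
  by apply: (@phi_inj _ alpha sigma); rewrite phia phi3 // s4.
have ep : ct (phi y) = [:: 3; 42; 3; 3] by rewrite phia ct_sigma e1.
rewrite /zig ea eqxx /= az.
have := ct_in (phi (phi y)); rewrite !fs_phi f3 => /corner_tuples3 /and3P[_ _].
rewrite last_ct_phi1 // ep -last_ct_phi1 // phi3 // e2 /= !inE => /orP[] /eqP e3; last first.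
  by rewrite e3.
case: (@no_double_large _ _ _ alphaK deg3 ct_in a).
- exact: fs_head ea.
- by rewrite phiE az ct_sigma e3.
- by rewrite ea.
Qed.

Lemma zig_sigma4 d : zig d -> sigma (sigma (sigma (sigma d))) = d.
Proof. by case/andP=> /eqP e _; apply: sigma4; rewrite e. Qed.

Lemma zag_sigma4 d : zag d -> sigma (sigma (sigma (sigma d))) = d.
Proof. by case/andP=> /eqP e _; apply: sigma4; rewrite e. Qed.

Lemma zig_sigma d : zig d -> zag (sigma d).
Proof. by move/zig_alpha/zig_phi; rewrite phia. Qed.

Let on_zig e := [|| zig e, zig (sigma e), zig (sigma (sigma e)) | zig (sigma (sigma (sigma e)))].

Lemma zag_on_zig d : zag d -> zig (sigma (sigma (sigma d))).
Proof. by move/zag_alpha/zag_turn; rewrite alphaK. Qed.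

Let s_inj := @perm_inj _ sigma.

Lemma zag_turn_alpha d : zag d -> alpha (sigma (sigma (sigma (alpha d)))) = phi (sigma d).
Proof.
move=> z; have z' := zag_alpha z; apply: (@phi_inj _ alpha sigma).
rewrite phia (zag_sigma4 z') -phia phi3 //.
by case/andP: z' => /eqP /fs_head ->.
Qed.

Lemma on_zig_sigma4 e : on_zig e -> sigma (sigma (sigma (sigma e))) = e.
Proof. by case/or4P=> /zig_sigma4 z; do ?[exact: z | apply: s_inj]. Qed.

Lemma on_zig_all d : zig d -> forall e, on_zig e.
Proof.
move=> zd; apply: (@conn_ind _ _ _ conn on_zig d); rewrite /on_zig ?zd // => e oe;
  have e4 := on_zig_sigma4 oe; case/or4P: oe => z.
- by rewrite e4 z !orbT.
- by rewrite z.
- by rewrite z orbT.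
- by rewrite z !orbT.
- by rewrite zig_alpha.
- have f3 : fs (sigma e) = 3 by case/andP: z => /eqP /fs_head ->.
  have -> : alpha e = sigma (alpha (phi (sigma e))).
    by apply: (@phi_inj _ alpha sigma); rewrite phia; apply: esym (phi3 f3).
  by rewrite (zag_on_zig (zag_alpha (zig_phi z))) !orbT.
- have := zag_turn (zig_sigma z); move/zig_alpha; rewrite zag_turn_alpha; last exact: zig_sigma.
  by rewrite e4 phiE => ->; rewrite orbT.
- by have := zag_turn (zig_sigma z); rewrite e4 => ->; rewrite !orbT.
Qed.

Hypothesis all_on_zig : forall e, on_zig e.

Let s4 e : sigma (sigma (sigma (sigma e))) = e.
Proof. exact: on_zig_sigma4. Qed.

Lemma antiprism_types e :
  [\/ zig e, zag e, ct e = [:: 3; 42; 3; 3] | ct e = [:: 42; 3; 3; 3] /\ zig (sigma e)].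
Proof.
case/or4P: (all_on_zig e) => z; first by constructor 1.
- constructor 4; split=> //; case/andP: z => /eqP + _; rewrite ct_sigma.
  by move/(congr1 (rotr 1)); rewrite rotK.
- constructor 3; case/andP: z => /eqP + _; rewrite !ct_sigma.
  by move/(congr1 (rotr 1 \o rotr 1)); rewrite /= !rotK.
by constructor 2; rewrite -(s4 e); apply: zig_sigma.
Qed.

Let large d := ct d == [:: 42; 3; 3; 3].
(* The large corner at the other end of the zig at [d]. *)
Let psi d := sigma (sigma (sigma (alpha (sigma d)))).

Lemma large_zig d : large d -> zig (sigma d).
Proof.
by move/eqP => l; case: (antiprism_types d) => [/andP[/eqP]|/andP[/eqP]| |[]]; rewrite l.
Qed.

Lemma large_of_zig d : zig d -> large (sigma (sigma (sigma d))).
Proof. by case/andP=> /eqP e _; rewrite /large !ct_sigma e. Qed.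

Lemma clip_large d : clip (fs d) = 42 -> large d.
Proof.
by rewrite -head_ct; case: (antiprism_types d) => [/andP[/eqP e _]|/andP[/eqP e _]|e|[e _]];
  rewrite /large e.
Qed.

Lemma antiprism_large_phi d : large d -> large (phi d).
Proof. by move=> ld; apply: clip_large; rewrite fs_phi -head_ct (eqP ld). Qed.

Lemma antiprism_large_psi d : large d -> large (psi d).
Proof. by move=> ld; apply: large_of_zig; apply: zig_alpha; apply: large_zig. Qed.

Lemma antiprism_psi_flip d : large d -> phi (psi (phi d)) = psi d.
Proof.
move=> /large_zig z; have f3 : fs (sigma d) = 3 by case/andP: z => /eqP /fs_head ->.
have zx := zag_alpha (zig_phi z); set x := alpha (phi (sigma d)) in zx.
have ad : alpha d = sigma x.
  by apply: (@phi_inj _ alpha sigma); rewrite phia; apply: esym (phi3 f3).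
have ax : alpha (sigma (sigma (sigma x))) = phi (phi x).
  by have := zag_turn_alpha (zag_alpha zx); rewrite alphaK.
by rewrite /psi (phiE d) ad ax (phiE (phi x)) s4 phia /x phia phiE.
Qed.

Lemma antiprism_psiK d : large d -> psi (psi d) = d.
Proof. by move=> _; rewrite /psi s4 alphaK s4. Qed.

Lemma antiprism_fs_psi d : large d -> fs (psi d) = fs d.
Proof. exact: (@mirror_size _ alpha sigma large psi antiprism_large_phi antiprism_large_psi antiprism_psi_flip antiprism_psiK). Qed.

Lemma antiprism_fs_constant d e : large d -> large e -> fs e = fs d.
Proof.
move=> ld; set N := fs d.
pose Q x := forall y, y \in [:: x; sigma x; sigma (sigma x); sigma (sigma (sigma x))] ->
  large y -> fs y = N.
suff allQ x : Q x by move=> le; apply: (allQ e); rewrite ?mem_head.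
apply: (@conn_ind _ _ _ conn Q d).
- by move=> y; rewrite !inE => /or4P[] /eqP -> //; rewrite /large ?ct_sigma (eqP ld).
- move=> {}x Qx y; rewrite s4 => yin; apply: Qx; move: yin; rewrite !inE.
  by case/or4P=> ->; rewrite ?orbT.
move=> {}x Qx y yin ly; case: (antiprism_types x) => [z|z|ex|[ex zs]].
- have lx := large_of_zig z; rewrite -(Qx _ _ lx) ?inE ?eqxx ?orbT //.
  rewrite -(antiprism_fs_psi lx) /psi s4; congr fs.
  have /andP[/eqP ea _] := zig_alpha z.
  by move: yin ly; rewrite !inE => /or4P[] /eqP -> //; rewrite /large ?ct_sigma ea.
- have /andP[/eqP ex /eqP ea] := z.
  have lx : large (sigma (sigma x)) by rewrite /large !ct_sigma ex.
  rewrite -(Qx _ _ lx) ?inE ?eqxx ?orbT //.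
  have -> : y = sigma (sigma (alpha x)).
    by move: yin ly; rewrite !inE => /or4P[] /eqP -> //; rewrite /large ?ct_sigma ea.
  have la : large (sigma (sigma (alpha x))) by rewrite /large !ct_sigma ea.
  (* [psi] sends the large corner at the far end of the zag to [alpha (sigma x)], which lies on the
     same face as the large corner at the near end but at another vertex. *)
  rewrite -(antiprism_fs_psi la) /psi (zag_turn_alpha z) phiE s4.
  by rewrite -(fs_phi _ _ (alpha (sigma x))) phia.
- have la : large (alpha x) by apply: clip_large; rewrite -(ct1 alphaK deg3) ex.
  have ls : large (sigma x) by rewrite /large ct_sigma ex.
  rewrite -(Qx _ _ ls) ?inE ?eqxx ?orbT // -phia fs_phi; congr fs.
  by move: yin ly; rewrite !inE => /or4P[] /eqP -> //; rewrite /large ?ct_sigma (eqP la).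
have lp : large (phi x) by apply: antiprism_large_phi; apply/eqP.
have ea : ct (alpha x) = [:: 3; 42; 3; 3] by rewrite ct_alpha (eqP lp).
rewrite -(Qx x) ?inE ?eqxx //; last by rewrite /large ex.
rewrite -(fs_phi _ _ x); congr fs; rewrite phiE.
by move: yin ly; rewrite !inE => /or4P[] /eqP -> //; rewrite /large ?ct_sigma ea.
Qed.

Lemma all_on_zig_antiprism : D -> is_antiprism alpha sigma.
Proof.
move=> d0.
have [d ld] : exists d, large d.
  case: (antiprism_types d0) => [z|/andP[/eqP e _]|e|[e _]].
  - by exists (sigma (sigma (sigma d0))); apply: large_of_zig.
  - by exists (sigma (sigma d0)); rewrite /large !ct_sigma e.
  - by exists (sigma d0); rewrite /large ct_sigma e.
  - by exists d0; apply/eqP.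
set N := fs d.
have N42 : 42 <= N.
  by have := head_ct alpha sigma d; rewrite (eqP ld) /= /clip -/N; lia.
have fsN e : fs e = if large e then N else 3.
  case: ifP => [le|]; first exact: antiprism_fs_constant.
  rewrite /large; case: (antiprism_types e) => [/andP[/eqP e1 _]|/andP[/eqP e1 _]|e1|[e1 _]];
    rewrite e1 //= => _; exact: fs_head e1.
have cs e : perm_eq (corner_sizes alpha sigma e) (N :: nseq 3 3).
  have orb : fingraph.orbit sigma e = [:: e; sigma e; sigma (sigma e); sigma (sigma (sigma e))].
    have o4 : fingraph.order sigma e = 4.
      have := size_ct alpha sigma e; rewrite /vdeg => <-.
      by case: (antiprism_types e) => [/andP[/eqP -> _]|/andP[/eqP -> _]|->|[-> _]].
    by rewrite /fingraph.orbit o4.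
  rewrite /corner_sizes orb /= !fsN /large !ct_sigma; apply/seq.permP => p.
  by case: (antiprism_types e) => [/andP[/eqP -> _]|/andP[/eqP -> _]|->|[-> _]] /=; lia.
have [] := @ring_count _ alpha sigma N 3 3 _ cs; first by lia.
rewrite (card_darts_edges alphaK alpha_neq) => eD eV e3V eF pF.
exists N; split.
- lia.
- nia.
(* Now there are 2V edges and V triangles, and again two faces are left. *)
- have c2 : count_mem N (face_sizes alpha sigma) = 2 by nia.
  have c3 : count_mem 3 (face_sizes alpha sigma) = 2 * N by nia.
  by move: pF; rewrite c2 c3.
- by move=> e; apply: perm_trans (cs e) _; apply/seq.permP => p /=; lia.
Qed.

End Antiprism.

(** A single edge with an excluded pattern starts a ladder or strip that fills the map and makes it
    a prism or an antiprism. *)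
Lemma PCC_joined (D : finType) (alpha sigma : {perm D}) : PCC alpha sigma -> forall d,
  joined_sizes (corner_type alpha sigma d) (corner_type alpha sigma (alpha d)).
Proof.
case=> -[inv conn noloop nomulti euler] pos deg3 not_prism not_antiprism d.
have alphaK : involutive alpha by move=> x; case: (inv x).
have alpha_neq x : alpha x != x by case: (inv x).
have fs3 := fs_ge3 alphaK deg3 noloop nomulti.
have ct_in := ct_mem deg3 fs3 pos.
apply/andP; split; apply/negP.
  case/and3P=> /eqP h /eqP l /eqP n; apply: not_prism.
  have r : rung alpha sigma d.
    apply: opposite_large => //; first by apply: clip_small; rewrite -?head_ct.
    rewrite ct_phi; move: n; have := deg3 (alpha d); rewrite -(size_ct alpha).
    by case: (corner_type _ _ _) => [|x [|y [|z s]]].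
  by apply: all_on_rung_prism => //; apply: on_rung_all r.
case/andP=> /eqP e; rewrite !inE => e'; apply: not_antiprism.
have [z zz] : exists z, zig alpha sigma z.
  (* The two types in the pattern are those of a zag and of a zig; a zag has a zig at the same
     vertex. *)
  case/orP: e' => e'; last by exists d; rewrite /zig -e e'.
  exists (sigma (sigma (sigma d))); apply: zag_on_zig => //.
  by rewrite /zag -e e'.
by apply: all_on_zig_antiprism => //; apply: on_zig_all zz.
Qed.

Theorem theorem3p1 (D : finType) (alpha sigma : {perm D}) :
  PCC alpha sigma -> (nverts sigma <= 208)%N.
Proof.
move=> pcc; have joined_ok := PCC_joined pcc.
case: pcc => -[inv conn noloop nomulti euler] pos deg3 _ _.
have alphaK : involutive alpha by move=> x; case: (inv x).
have alpha_neq x : alpha x != x by case: (inv x).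
have fs3 := fs_ge3 alphaK deg3 noloop nomulti.
apply: (nverts_le208 alphaK alpha_neq euler).
  exact: vertex_charge.
exact: total_corner_charge.
Qed.
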